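(* Let $(\mathfrak g,\langle\cdot,\cdot\rangle)$ be a pseudo-Euclidean vector space, let $B:\mathfrak g\to\mathfrak g$ be a skew-symmetric endomorphism, let $u\in\mathfrak g$ with $\langle u,u\rangle\neq 0$, and let $\lambda\in\mathbb R\setminus\{0\}$; assume $Bu=0$. Define $E=B+\lambda\,\mathrm{id}_{\mathfrak g}$ and $$[x,y]=\langle x,u\rangle E(y)-\langle y,u\rangle E(x),\qquad x,y\in\mathfrak g.$$ Then $(\mathfrak g,[\cdot,\cdot],\langle\cdot,\cdot\rangle)$ is a pseudo-Euclidean Lie algebra, and the associated simply connected Lie group, endowed with the left-invariant pseudo-Riemannian metric associated to $\langle\cdot,\cdot\rangle$, has constant sectional curvature $$k=-\langle u,u\rangle\lambda^2,$$ and this metric is complete if and only if $\langle\cdot,\cdot\rangle$ is positive definite. Moreover, every Lie algebra of a Riemannian Lie group endowed with a left-invariant metric of negative constant curvature is isomorphic to a pseudo-Euclidean Lie algebra $(V,[\cdot,\cdot]_V,\langle\cdot,\cdot\rangle_V)$ of the following form: $(V,\langle\cdot,\cdot\rangle_V)$ is a pseudo-Euclidean vector space and $$[x,y]_V=\langle x,u'\rangle_V\,E'(y)-\langle y,u'\rangle_V\,E'(x),\qquad x,y\in V,\qquad E'=B'+\lambda'\,\mathrm{id}_V,$$ for some skew-symmetric endomorphism $B':V\to V$, some $u'\in V$ with $\langle u',u'\rangle_V\neq 0$ and $B'u'=0$, and some $\lambda'\in\mathbb R\setminus\{0\}$.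
   Context: A pseudo-Euclidean vector space is a finite-dimensional real vector space with a nondegenerate symmetric bilinear form (of any signature $(q,n-q)$); it is Euclidean if the form is positive definite. Skew-symmetric means skew-symmetric with respect to $\langle\cdot,\cdot\rangle$. A pseudo-Euclidean Lie algebra is a real finite-dimensional Lie algebra with such a form (no invariance required); it corresponds to a Lie group with a left-invariant pseudo-Riemannian metric. A Riemannian Lie group is a Lie group with a left-invariant Riemannian metric; its Lie algebra carries the induced inner product. Let $\nabla$ be the Levi-Civita connection and put $K(X,Y)=\nabla_{[X,Y]}-[\nabla_X,\nabla_Y]$ and $(X\wedge Y)(Z)=\langle X,Z\rangle Y-\langle Y,Z\rangle X$; constant sectional curvature $k$ means $K(X,Y)=k\,X\wedge Y$ for all $X,Y$. Complete means geodesically complete.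
   Formalization: ''Complete iff positive definite'' is stated for forms that are not negative definite (it fails for negative definite ones, whose metrics are shown complete); the ''moreover'' part assumes the Lie group has positive dimension, since in dimension 0 no u' with nonzero square exists. *)

(* Defs.v *)
From HB Require Import structures.
From mathcomp Require Import all_boot all_order all_algebra.
From mathcomp Require Import all_classical all_reals all_analysis.
Import numFieldNormedType.Exports.

Set Implicit Arguments.
Unset Strict Implicit.
Unset Printing Implicit Defensive.

Import Order.TTheory GRing.Theory Num.Theory.
Local Open Scope classical_set_scope.
Local Open Scope ring_scope.

Section PseudoEuclideanLieAlgebra.
Context {R : realType} {g : vectType R}.
Implicit Types (br nabla : g -> g -> g) (form : {symmetric g}).

Definition positive_definite form := forall x, x != 0 -> 0 < form x x.
(* The metrics of a form and of its opposite have the same Levi-Civita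
   connection, hence the same geodesics: completeness does not distinguish a
   negative definite form from a positive definite one. *)
Definition negative_definite form := forall x, x != 0 -> form x x < 0.

Definition skew_symmetric form (B : 'End(g)) :=
  forall x y, form (B x) y = - form x (B y).

Record is_lie_bracket br : Prop := {
  lie_linearl : forall y, linear (br^~ y);
  lie_linearr : forall x, linear (br x);
  lie_alternating : forall x, br x x = 0;
  lie_jacobi : forall x y z,
    br x (br y z) + br y (br z x) + br z (br x y) = 0 }.

Definition pseudo_euclidean_lie_algebra br form :=
  nondegenerate form /\ is_lie_bracket br.

(* The Levi-Civita connection of a left-invariant metric maps left-invariant
   fields to left-invariant fields, and is determined by its values on them;
   for such fields <Y, Z> is constant, so that being metric amounts to
   <nabla_X Y, Z> + <Y, nabla_X Z> = X <Y, Z> = 0. *)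
Record is_levi_civita br form nabla : Prop := {
  levi_civita_linearl : forall y, linear (nabla^~ y);
  levi_civita_linearr : forall x, linear (nabla x);
  levi_civita_torsion_free : forall x y, nabla x y - nabla y x = br x y;
  levi_civita_metric : forall x y z,
    form (nabla x y) z + form y (nabla x z) = 0 }.

Definition curvature br nabla x y z : g :=
  nabla (br x y) z - (nabla x (nabla y z) - nabla y (nabla x z)).

Definition wedge_op form x y z : g := form x z *: y - form y z *: x.

(* The curvature is a tensor, hence it is enough to evaluate it on
   left-invariant fields. *)
Definition constant_curvature br form nabla (k : R) :=
  forall x y z, curvature br nabla x y z = k *: wedge_op form x y z.

Definition special_bracket form (u : g) (E : 'End(g)) x y : g :=
  form x u *: E y - form y u *: E x.

End PseudoEuclideanLieAlgebra.

Section Smooth.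
Context {R : realType}.

(* Only meant for open U; in finite dimension this is the usual C^k. *)
Fixpoint Ck (V W : normedModType R) (k : nat) (U : set V) (f : V -> W) : Prop :=
  if k is k'.+1 then
    (forall x, U x -> differentiable f x) /\ forall v, Ck k' U ('D_v f)
  else forall x, U x -> {for x, continuous f}.

Definition smooth_on (V W : normedModType R) (U : set V) (f : V -> W) :=
  forall k, Ck k U f.

End Smooth.

(* chart_map and chart_inv are unconstrained off chart_dom, resp. off its
   image chart_img. *)
Record chart (R : realType) (n : nat) (G : topologicalType) := Chart {
  chart_dom : set G;
  chart_map : G -> 'rV[R]_n;
  chart_inv : 'rV[R]_n -> G;
  chart_dom_open : open chart_dom;
  chart_img_open : open (chart_map @` chart_dom);
  chart_mapK : forall p, chart_dom p -> chart_inv (chart_map p) = p;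
  chart_map_continuous : forall p, chart_dom p -> {for p, continuous chart_map};
  chart_inv_continuous : forall z,
    (chart_map @` chart_dom) z -> {for z, continuous chart_inv} }.

Definition chart_img (R : realType) (n : nat) (G : topologicalType)
  (c : chart R n G) : set 'rV[R]_n := chart_map c @` chart_dom c.

HB.mixin Record isLieGroup (R : realType) (n : nat) G
    of Group G & Topological G := {
  atlas : set (chart R n G);
  atlas_cover : forall p : G, exists2 c, atlas c & chart_dom c p;
  atlas_compatible : forall c c', atlas c -> atlas c' ->
    smooth_on (chart_map c @` (chart_dom c `&` chart_dom c'))
              (chart_map c' \o chart_inv c);
  lie_group_hausdorff : hausdorff_space G;
  lie_group_second_countable : @second_countable G;
  mulg_continuous : continuous (fun pq : G * G => (pq.1 * pq.2)%g);
  invg_continuous : continuous (fun p : G => (p^-1)%g);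
  mulg_smooth : forall c1 c2 c3, atlas c1 -> atlas c2 -> atlas c3 ->
    smooth_on [set z : 'rV[R]_n * 'rV[R]_n |
                [/\ chart_img c1 z.1, chart_img c2 z.2 &
                    chart_dom c3 (chart_inv c1 z.1 * chart_inv c2 z.2)%g]]
              (fun z => chart_map c3 (chart_inv c1 z.1 * chart_inv c2 z.2)%g);
  invg_smooth : forall c1 c2, atlas c1 -> atlas c2 ->
    smooth_on [set z | chart_img c1 z /\ chart_dom c2 ((chart_inv c1 z)^-1)%g]
              (fun z => chart_map c2 ((chart_inv c1 z)^-1)%g) }.

#[short(type="lieGroupType")]
HB.structure Definition LieGroup (R : realType) (n : nat) :=
  {G of Group G & Topological G & isLieGroup R n G}.

Definition simply_connected (R : realType) (G : topologicalType) :=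
  (forall p q : G, exists c : R -> G,
     [/\ {within `[0, 1], continuous c}, c 0 = p & c 1 = q]) /\
  (forall c : R -> G, {within `[0, 1], continuous c} -> c 0 = c 1 ->
     exists H : R * R -> G,
       [/\ {within `[0, 1] `*` `[0, 1], continuous H},
           forall t, t \in `[0, 1] -> H (0, t) = c t,
           forall t, t \in `[0, 1] -> H (1, t) = c 0 &
           forall s, s \in `[0, 1] -> H (s, 0) = c 0 /\ H (s, 1) = c 0]).

Section LieGroupTheory.
Context {R : realType} {n : nat} {G : lieGroupType R n}.

Definition smooth_fun (f : G -> R) :=
  forall c : chart R n G, atlas c -> smooth_on (chart_img c) (f \o chart_inv c).

(* In this section the chart c contains the neutral element and identifies the
   tangent space at 1 with 'rV[R]_n.  left_field c v is the derivation of
   C^oo(G) given by the left-invariant vector field with value v at 1. *)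
Definition left_field (c : chart R n G) (v : 'rV[R]_n) (f : G -> R) (p : G) : R :=
  'D_v (fun z => f (p * chart_inv c z)%g) (chart_map c 1%g).

Variables (g : vectType R) (c : chart R n G) (theta : g -> 'rV[R]_n).

(* theta identifies (g, br) with the Lie algebra of G: the tangent space at 1
   with the bracket of left-invariant vector fields. *)
Record is_lie_algebra_of (br : g -> g -> g) : Prop := {
  lie_algebra_chart : atlas c;
  lie_algebra_chart1 : chart_dom c 1%g;
  lie_algebra_linear : linear theta;
  lie_algebra_bijective : bijective theta;
  lie_algebra_bracket : forall x y (f : G -> R) p, smooth_fun f ->
    left_field c (theta (br x y)) f p =
      left_field c (theta x) (left_field c (theta y) f) p
    - left_field c (theta y) (left_field c (theta x) f) p }.

(* x t is the velocity of gamma at t, translated to the tangent space at 1. *)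
Definition left_velocity (gamma : R -> G) (x : R -> g) :=
  continuous gamma /\
  forall t : R, is_derive t 1
    (fun s => chart_map c ((gamma t)^-1 * gamma s)%g) (theta (x t)).

(* With x = sum_i x_i e_i and E_i the left-invariant field extending e_i, the
   velocity of gamma is gamma' = sum_i x_i E_i(gamma), so that
   nabla_gamma' gamma' = sum_i (x_i' E_i + x_i nabla_gamma' E_i) is the left
   translate of x' + nabla x x. *)
Definition geodesic (nabla : g -> g -> g) (gamma : R -> G) (x : R -> g) :=
  left_velocity gamma x /\
  forall t : R, is_derive t 1 (theta \o x) (- theta (nabla (x t) (x t))).

Definition geodesically_complete (nabla : g -> g -> g) :=
  forall (p : G) (v : g), exists (gamma : R -> G) (x : R -> g),
    [/\ geodesic nabla gamma x, gamma 0 = p & x 0 = v].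

End LieGroupTheory.

(* Main.v *)
Require Import Defs.
From HB Require Import structures.
From mathcomp Require Import all_boot all_order all_algebra.
From mathcomp Require Import all_classical all_reals all_analysis.
From mathcomp Require Import ring lra.
Import numFieldNormedType.Exports.
Import Order.TTheory GRing.Theory Num.Theory.
Local Open Scope ring_scope.

(** The first half is explicit. The Levi-Civita product of the bracket is
    nabla_x y = <x,u> B y + lambda (<x,y> u - <y,u> x), from which the Jacobi
    identity and the curvature follow by expansion. A geodesic with
    left-translated velocity x satisfies x' = - nabla_x x; hence <x,x> = C is
    constant and a = <x,u> solves the Riccati equation
    a' = lambda (a^2 - C <u,u>).

    If the form is indefinite, some initial velocity has C <u,u> < 0; the
    solution a of the Riccati equation is then a tangent, which blows up in
    finite time ([no_global_riccati]). If the form is definite, the constancy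
    of <x,x> keeps x in a compact set, so the equation x' = - nabla_x x is
    solved on the whole real line by [picard] ([geodesic_flow]). It remains to
    integrate a bounded velocity to a curve in the group
    ([curve_of_velocity]): in a chart at the neutral element this is an
    ordinary differential equation with locally Lipschitz coefficients, whose
    solution exists for a time that depends only on the bound of the velocity,
    so left translates of local solutions can be glued.

    For the converse, let the form be definite with curvature - K^2. In an
    orthonormal basis the Levi-Civita product is a linear map N from vectors to
    skew-symmetric matrices. Let D_v be the endomorphism x |-> nabla_x v. The
    curvature equation reads
      [nabla_x, D_v] = D_(nabla_x v) - D_v D_x + K^2 (<x,v> - x <v,.>),
    and tr D_v = - tr ad_v. The argument has three steps.

    Step 1: the algebra is not unimodular when its dimension n + 1 exceeds 1.
    Otherwise tr D_v = 0, and taking traces of the curvature equation against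
    powers of D_v determines, by induction, the traces of all powers: for a
    unit vector v,
      tr p(D_v) = p(0) + n/2 (p(K) + p(- K)) for every polynomial p.
    So n / 2 is the multiplicity of an eigenvalue, n is even, and some x <> 0
    satisfies nabla_x v = K x. The skew-symmetric nabla_x acts on a space of
    odd dimension n + 1, so it kills some unit vector y, and y is orthogonal
    to x. Then x spans the generalised kernel of D_y, which has dimension 1,
    but the projection of y to it is not orthogonal to y
    ([unimodular_dim0]).

    Step 2: let w be the unit vector in the direction of the vector that
    represents tr ad. Then D_w is self-adjoint, and the curvature equation for
    x = v = w writes D_w^2 - K^2 P, with P the projection to the orthogonal of
    w, as a commutator of a matrix with D_w; as it also commutes with D_w, the
    trace of its square vanishes, and D_w^2 = K^2 P. If both K and - K were
    eigenvalues, the plane of two corresponding eigenvectors would have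
    curvature + K^2; so D_w = K P or D_w = - K P ([shape_scalar]). Up to the
    sign of w, this says that the algebra fixes a point at infinity of
    hyperbolic space ([invariant_horosphere]).

    Step 3: what is left of nabla_x, once the part prescribed by that fixed
    point is subtracted, is a rotation A_x that fixes w. With S = A_w, the
    curvature equation becomes [S, A_x] = A_(S x) + K A_x for x orthogonal to
    w (S is skew-symmetric). Pairing with A_x and summing over an orthonormal
    basis kills the term in S, so A_x = 0 for x orthogonal to w, that is
    A_x = <x,w> S ([rotation_collinear]). This is the asserted form of the
    bracket, with B = S, u = w and lambda = K. *)

Set Implicit Arguments.
Unset Strict Implicit.
Unset Printing Implicit Defensive.
Local Open Scope classical_set_scope.
Local Open Scope ring_scope.

(** * Idempotents attached to eigenvalues *)
Lemma mxtrace_idempotent (F : fieldType) n (P : 'M[F]_n) :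
  P *m P = P -> \tr P = (\rank P)%:R.
Proof.
move=> PP; have PE := mulmx_base P.
have cr1 : row_base P *m col_base P = 1%:M.
  apply: (row_full_inj (col_base_full P)).
  apply: (row_free_inj (row_base_free P)).
  by rewrite mulmx1 mulmxA PE -mulmxA PE PP.
by rewrite -{1}PE mxtrace_mulC cr1 mxtrace1.
Qed.

(** The projection to the generalised eigenspace of a root a of the
    characteristic polynomial is a polynomial in A: take p = v q in a Bezout
    relation u (X - a)^m + v q = 1, where the characteristic polynomial is
    (X - a)^m q. Evaluating a formula for tr p(A) then gives the dimension of
    this eigenspace. *)
Lemma spectral_idempotent (F : fieldType) n (A : 'M[F]_n.+1) a :
  root (char_poly A) a ->
  exists p : {poly F}, [/\ p.[a] = 1,
    forall b, b != a -> root (char_poly A) b -> p.[b] = 0 &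
    horner_mx A p *m horner_mx A p = horner_mx A p].
Proof.
move=> chia; have chi0 := monic_neq0 (char_poly_monic A).
have [m [q]] := multiplicity_XsubC (char_poly A) a.
rewrite chi0 /= => qa0 chiE.
have m0 : (0 < m)%N.
  by case: m chiE chia => // ->; rewrite expr0 mulr1 (negPf qa0).
have : coprimep (('X - a%:P) ^+ m) q.
  by apply: coprimep_expl; rewrite coprimep_sym coprimep_XsubC.
move=> /Bezout_eq1_coprimepP[[u v] /= uv1].
have pE : v * q = 1 - u * ('X - a%:P) ^+ m by rewrite -uv1 [in RHS]addrC addKr.
exists (v * q); split.
- by rewrite pE !hornerE subrr expr0n gtn_eqF// mulr0 subr0.
- move=> b ba; rewrite chiE rootM -(prednK m0) root_exp_XsubC orbC.
  case/orP => [/eqP ab|/rootP qb0]; first by rewrite ab eqxx in ba.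
  by rewrite hornerM qb0 mulr0.
- have : horner_mx A ((v * q) * (u * ('X - a%:P) ^+ m)) = 0.
    have -> : v * q * (u * ('X - a%:P) ^+ m) = v * u * char_poly A.
      by rewrite chiE; ring.
    by rewrite rmorphM /= Cayley_Hamilton mulr0.
  rewrite -[u * _](subKr 1) -pE; move: (v * q) => p.
  by rewrite mulrBr mulr1 rmorphB rmorphM /= => /eqP; rewrite subr_eq0 => /eqP.
Qed.

Lemma horner_mx_eigenvector (F : fieldType) n (A : 'M[F]_n.+1) p a
    (x : 'rV_n.+1) :
  x *m A = a *: x -> x *m horner_mx A p = p.[a] *: x.
Proof.
move=> xA; elim/poly_ind: p => [|p c IH].
  by rewrite rmorph0 mulmx0 horner0 scale0r.
rewrite rmorphD rmorphM /= horner_mx_X horner_mx_C mulmxDr mul_mx_scalar.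
by rewrite mulmxA IH -scalemxAl xA !hornerE scalerDl scalerA.
Qed.

(** * The standard inner product of row vectors *)
Section Dot.
Context {R : realFieldType}.
Implicit Types (n : nat).

Definition dot n (x y : 'rV[R]_n) : R := (x *m y^T) 0 0.

Lemma dotC n (x y : 'rV_n) : dot x y = dot y x.
Proof. by rewrite /dot -[x *m _]trmxK trmx_mul trmxK mxE. Qed.

Lemma dot_linearr n (x : 'rV_n) : linear_for *%R (dot x).
Proof.
by move=> a y z; rewrite /dot linearP /= mulmxDr -scalemxAr !mxE.
Qed.

HB.instance Definition _ n (x : 'rV_n) :=
  GRing.isLinear.Build R _ _ _ (dot x) (dot_linearr x).

Lemma dotDl n (x y z : 'rV_n) : dot (x + y) z = dot x z + dot y z.
Proof. by rewrite !(dotC _ z) linearD. Qed.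
Lemma dotBl n (x y z : 'rV_n) : dot (x - y) z = dot x z - dot y z.
Proof. by rewrite !(dotC _ z) linearB. Qed.
Lemma dotNl n (x z : 'rV_n) : dot (- x) z = - dot x z.
Proof. by rewrite !(dotC _ z) linearN. Qed.
Lemma dotZl n a (x z : 'rV_n) : dot (a *: x) z = a * dot x z.
Proof. by rewrite !(dotC _ z) linearZ. Qed.
Lemma dotDr n (x y z : 'rV_n) : dot z (x + y) = dot z x + dot z y.
Proof. by rewrite linearD. Qed.
Lemma dotBr n (x y z : 'rV_n) : dot z (x - y) = dot z x - dot z y.
Proof. by rewrite linearB. Qed.
Lemma dotNr n (x z : 'rV_n) : dot z (- x) = - dot z x.
Proof. by rewrite linearN. Qed.
Lemma dotZr n a (x z : 'rV_n) : dot z (a *: x) = a * dot z x.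
Proof. by rewrite linearZ. Qed.
Definition dotE := (dotDl, dotBl, dotNl, dotZl, dotDr, dotBr, dotNr, dotZr).

Lemma dot_mul n (A : 'M[R]_n) (x y : 'rV_n) : dot (x *m A) y = dot x (y *m A^T).
Proof. by rewrite /dot trmx_mul trmxK mulmxA. Qed.

Lemma mul_outer n (x y z : 'rV[R]_n) : x *m (y^T *m z) = dot x y *: z.
Proof. by rewrite mulmxA [x *m _]mx11_scalar mul_scalar_mx. Qed.

Lemma dot_mxtrace n (x y : 'rV[R]_n) : \tr (x^T *m y) = dot y x.
Proof. by rewrite mxtrace_mulC trace_mx11. Qed.

Lemma dot_gt0 n (x : 'rV[R]_n) : x != 0 -> 0 < dot x x.
Proof.
move=> x0; have sq i : 0 <= x 0 i * x^T i 0 by rewrite mxE -expr2 sqr_ge0.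
rewrite lt_neqAle /dot mxE sumr_ge0// andbT eq_sym.
apply: contra x0; rewrite psumr_eq0// => /allP xi.
apply/eqP/rowP => i; have := xi i (mem_index_enum _).
by rewrite !mxE mulf_eq0 orbb => /eqP.
Qed.

Lemma dot_eq0 n (x : 'rV[R]_n) : (dot x x == 0) = (x == 0).
Proof.
apply/idP/eqP => [|->]; last by rewrite linear0.
by apply: contraTeq => /dot_gt0; rewrite lt_def => /andP[].
Qed.

Lemma mulmx_inj n (A B : 'M[R]_n) :
  (forall x : 'rV_n, x *m A = x *m B) -> A = B.
Proof. by move=> AB; apply/row_matrixP => i; rewrite !rowE AB. Qed.

Lemma mxtrace_mulT_ge0 n (A : 'M[R]_n) : 0 <= \tr (A *m A^T).
Proof.
rewrite /mxtrace; apply: sumr_ge0 => i _; rewrite mxE; apply: sumr_ge0 => j _.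
by rewrite mxE -expr2 sqr_ge0.
Qed.

Lemma mxtrace_mulT_eq0 n (A : 'M[R]_n) : \tr (A *m A^T) = 0 -> A = 0.
Proof.
have row_ge0 i : 0 <= (A *m A^T) i i.
  by rewrite mxE sumr_ge0// => j _; rewrite mxE -expr2 sqr_ge0.
move=> /eqP; rewrite psumr_eq0// => /allP A0.
apply/row_matrixP => i; rewrite row0; apply/eqP; rewrite -dot_eq0.
have /eqP Ai0 := A0 i (mem_index_enum _); rewrite -[X in _ == X]Ai0 /dot !mxE.
by apply/eqP; apply: eq_bigr => j _; rewrite !mxE.
Qed.

Lemma skew_odd_singular n (A : 'M[R]_n) : A^T = - A -> odd n -> \det A = 0.
Proof.
move=> skA on; have := det_tr A; rewrite skA -scaleN1r detZ -signr_odd on.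
by rewrite expr1 mulN1r => /eqP; rewrite eq_sym -addr_eq0 -mulr2n mulrn_eq0 => /eqP.
Qed.

End Dot.

(** * Levi-Civita products of constant negative curvature *)

(** Vectors are rows, so that the endomorphism nabla_x is y |-> y *m N x. The
    bracket [br] is the one that makes the product torsion-free, and
    [N_curvature] is K(x,y) = - K^2 x wedge y. *)

Section NegativeCurvature.
Context {R : rcfType} {n : nat}.
Variables (N : {linear 'rV[R]_n.+1 -> 'M[R]_n.+1}) (K : R).
Hypothesis N_skew : forall x, (N x)^T = - N x.
Let br (x y : 'rV[R]_n.+1) : 'rV[R]_n.+1 := y *m N x - x *m N y.
Hypothesis N_curvature : forall x y : 'rV_n.+1,
  N (br x y) - (N y *m N x - N x *m N y) = K ^+ 2 *: (y^T *m x - x^T *m y).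
Hypothesis K_gt0 : 0 < K.

(** The matrix of x |-> nabla_x v. *)
Definition Dmx (v : 'rV[R]_n.+1) : 'M[R]_n.+1 := lin1_mx (fun x => v *m N x).

Lemma mul_Dmx v (x : 'rV_n.+1) : x *m Dmx v = v *m N x.
Proof.
have lin : linear (fun x => v *m N x).
  by move=> a y z; rewrite linearP /= mulmxDr -scalemxAr.
pose f : {linear 'rV_n.+1 -> 'rV_n.+1} := HB.pack (fun x => v *m N x)
   (GRing.isLinear.Build _ _ _ _ _ lin).
by rewrite (mul_rV_lin1 f).
Qed.

Lemma Dmx_linear : linear Dmx.
Proof.
move=> a v w; apply: mulmx_inj => x.
by rewrite mulmxDr -scalemxAr !mul_Dmx mulmxDl scalemxAl.
Qed.
HB.instance Definition _ := GRing.isLinear.Build R _ _ _ Dmx Dmx_linear.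

Lemma dot_N_skew (x y z : 'rV_n.+1) : dot (y *m N x) z = - dot y (z *m N x).
Proof. by rewrite dot_mul N_skew mulmxN linearN. Qed.

Lemma dot_N_diag (x y : 'rV_n.+1) : dot (y *m N x) y = 0.
Proof. by have := dot_N_skew x y y; rewrite [dot y _]dotC; lra. Qed.

(** The image of D_v is orthogonal to v because nabla_x is skew. *)
Lemma Dmx_tr v : Dmx v *m v^T = 0.
Proof.
apply/row_matrixP => i; rewrite row_mul rowE mul_Dmx row0.
by apply/rowP => j; rewrite ord1 [LHS]dot_N_diag mxE.
Qed.

(** The curvature equation applied to v, read as an identity between
    endomorphisms of its second argument. *)
Lemma N_Dmx_commutator (x v : 'rV_n.+1) :
  N x *m Dmx v - Dmx v *m N x =
  Dmx x *m Dmx v - Dmx (v *m N x) + K ^+ 2 *: (v^T *m x - (dot v x)%:M).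
Proof.
apply: mulmx_inj => y; have := congr1 (mulmx v) (N_curvature x y).
rewrite /br [N (_ - _)]linearB /= -scalemxAr !(mulmxBr, mulmxDr) -scalemxAr.
rewrite !mulmxBr !mul_outer mul_mx_scalar !mulmxA !mul_Dmx (dotC y v).
move: (v *m _) (_ *m N x) (v *m _) (_ *m N y) => a b c d.
by move=> /rowP E; apply/rowP => i; have := E i; rewrite !mxE; lra.
Qed.

(** Multiply [N_Dmx_commutator] by D_v^j and take traces: the commutator
    disappears, because D_v commutes with its powers. *)
Lemma mxtrace_Dmx_pow (x v : 'rV_n.+1) j :
  \tr (Dmx x * Dmx v ^+ j.+1) = \tr (Dmx (v *m N x) * Dmx v ^+ j)
    + K ^+ 2 * (dot v x * \tr (Dmx v ^+ j) - dot (x *m Dmx v ^+ j) v).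
Proof.
have := congr1 (fun A => \tr (A *m Dmx v ^+ j)) (N_Dmx_commutator x v).
rewrite /= !mulmxDl !mulNmx -!mulmxA !raddfD /= !raddfN /=.
have -> : \tr (Dmx v *m (N x *m Dmx v ^+ j)) = \tr (N x *m (Dmx v *m Dmx v ^+ j)).
  rewrite mxtrace_mulC -mulmxA; congr (\tr (_ *m _)).
  by rewrite -[LHS]exprSr -[RHS]exprS.
rewrite subrr -scalerBr -scalemxAl mxtraceZ mulmxBl raddfB /= -mulmxA dot_mxtrace.
rewrite mul_scalar_mx mxtraceZ => E; apply/eqP; rewrite -subr_eq0.
apply/eqP; move: E; rewrite [Dmx v ^+ j.+1]exprS; lra.
Qed.

Section Unimodular.
Hypothesis trD0 : forall v, \tr (Dmx v) = 0.

Lemma mxtrace_Dmx_mul (x v : 'rV_n.+1) :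
  \tr (Dmx x * Dmx v) = K ^+ 2 * n%:R * dot v x.
Proof.
have := mxtrace_Dmx_pow x v 0; rewrite expr1 expr0 !mulr1 trD0 add0r => ->.
by rewrite mxtrace1 mulmx1 -natr1 (dotC x); ring.
Qed.

Lemma dot_mul_Dmx_pow (x v : 'rV_n.+1) j : dot (x *m Dmx v ^+ j.+1) v = 0.
Proof.
rewrite exprSr -[_ * _]/(_ *m _); move: (Dmx v ^+ j) => A.
by rewrite /dot -!mulmxA Dmx_tr !mulmx0 mxE.
Qed.

(** The differential of v |-> tr D_v^(j+1) is radial. In the induction the
    term tr (D_(nabla_x v) D_v^j) is a multiple of <v, nabla_x v> = 0. *)
Lemma mxtrace_Dmx_proportional v j : exists c, forall x : 'rV_n.+1,
  \tr (Dmx x * Dmx v ^+ j) = c * dot v x.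
Proof.
elim: j => [|[|j] [c IH]].
- by exists 0 => x; rewrite mulr1 trD0 mul0r.
- by exists (K ^+ 2 * n%:R) => x; rewrite expr1 mxtrace_Dmx_mul.
exists (K ^+ 2 * \tr (Dmx v ^+ j.+1)) => x.
rewrite mxtrace_Dmx_pow IH dotC dot_N_diag dot_mul_Dmx_pow; ring.
Qed.

Lemma mxtrace_Dmx_powSS (v : 'rV_n.+1) j :
  \tr (Dmx v ^+ j.+3) = K ^+ 2 * dot v v * \tr (Dmx v ^+ j.+1).
Proof.
rewrite exprS mxtrace_Dmx_pow; have [c ->] := mxtrace_Dmx_proportional v j.+1.
by rewrite dotC dot_N_diag dot_mul_Dmx_pow; ring.
Qed.

(** D_v behaves as if it were diagonal with eigenvalues 0, K and - K of
    multiplicities 1, n/2 and n/2. *)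
Lemma mxtrace_horner_Dmx (v : 'rV_n.+1) p : dot v v = 1 ->
  \tr (horner_mx (Dmx v) p) = p.[0] + n%:R / 2 * (p.[K] + p.[- K]).
Proof.
move=> v1.
have powE j : \tr (Dmx v ^+ j) = 0 ^+ j + n%:R / 2 * (K ^+ j + (- K) ^+ j).
  elim/ltn_ind: j => -[|[|[|j]]] IH.
  - by rewrite !expr0 mxtrace1 -natr1; field.
  - by rewrite !expr1 trD0; field.
  - by rewrite [LHS]mxtrace_Dmx_mul v1; field.
  by rewrite mxtrace_Dmx_powSS v1 IH 1?ltnW// !expr0n /= !exprS; field.
rewrite -(coefK p) poly_def !horner_sum !raddf_sum /= -big_split mulr_sumr.
rewrite -big_split /=; apply: eq_bigr => j _.
rewrite linearZ /= rmorphXn /= horner_mx_X mxtraceZ powE !hornerE; ring.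
Qed.

(** A unimodular algebra of dimension > 1 has no metric of constant negative
    curvature. *)
Lemma unimodular_dim0 : n = 0.
Proof.
case: (posnP n) => // n0; exfalso.
have trpD v p := @mxtrace_horner_Dmx v p.
have half0 : n%:R / 2 != 0 :> R by rewrite mulf_neq0 ?invr_eq0 ?pnatr_eq0 -?lt0n.
have K0 : K != 0 by rewrite gt_eqF.
have K2 : - K != K by rewrite lt_eqF// gtrN.
have chi_root v : dot v v = 1 ->
    [/\ root (char_poly (Dmx v)) 0, root (char_poly (Dmx v)) K
      & root (char_poly (Dmx v)) (- K)].
  move=> v1; set chi := char_poly _.
  (* By Cayley-Hamilton the trace formula applied to a multiple of chi is 0. *)
  have chiD q : q.[0] * chi.[0]
      + n%:R / 2 * (q.[K] * chi.[K] + q.[- K] * chi.[- K]) = 0.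
    have := trpD v (q * chi) v1.
    by rewrite rmorphM /= Cayley_Hamilton mulr0 mxtrace0 !hornerM.
  have hE := (hornerM, hornerD, hornerN, hornerXn, hornerX, hornerC).
  have e0 : - K ^+ 2 * chi.[0] = 0.
    by rewrite -[RHS](chiD ('X ^+ 2 - (K ^+ 2)%:P)) !hE; field.
  have eK : n%:R / 2 * (2 * K ^+ 2) * chi.[K] = 0.
    by rewrite -[RHS](chiD ('X * ('X + K%:P))) !hE; field.
  have eNK : n%:R / 2 * (2 * K ^+ 2) * chi.[- K] = 0.
    by rewrite -[RHS](chiD ('X * ('X - K%:P))) !hE; field.
  have K20 : K ^+ 2 != 0 by rewrite expf_neq0.
  have cancel0 a b : a != 0 -> a * b = 0 -> b = 0 :> R.
    by move=> a0 /eqP; rewrite mulf_eq0 (negPf a0) => /eqP.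
  split; apply/rootP.
  - by apply: cancel0 e0; rewrite oppr_eq0.
  - by apply: cancel0 eK; rewrite mulf_neq0 ?half0 ?mulf_neq0 ?pnatr_eq0.
  - by apply: cancel0 eNK; rewrite mulf_neq0 ?half0 ?mulf_neq0 ?pnatr_eq0.
pose e : 'rV[R]_n.+1 := 'e_0.
have e1 : dot e e = 1.
  by rewrite /dot /e trmx_delta mul_delta_mx !mxE eqxx.
have [r0 rK rNK] := chi_root e e1.
(* The generalised K-eigenspace has dimension n / 2, an integer. *)
have n_even : ~~ odd n.
  have [p [pK pb pp]] := spectral_idempotent rK.
  have := mxtrace_idempotent pp; rewrite trpD// pK !pb//; last by rewrite eq_sym.
  move=> E; have : n%:R = (\rank (horner_mx (Dmx e) p)).*2%:R :> R.
    by rewrite -muln2 natrM -E; field.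
  by move=> /eqP; rewrite eqr_nat => /eqP ->; rewrite odd_double.
have /eigenvalueP[x ex x0] : eigenvalue (Dmx e) K.
  by rewrite eigenvalue_root_char.
have [y y0 yx] : exists2 y : 'rV[R]_n.+1, y != 0 & y *m N x = 0.
  have /eqP/det0P[y y0 yx] : \det (N x) = 0.
    by apply: skew_odd_singular => //=; rewrite N_skew.
  by exists y.
have {y y0 yx} [y y1 yx] : exists2 y : 'rV[R]_n.+1, dot y y = 1 & y *m N x = 0.
  exists ((Num.sqrt (dot y y))^-1 *: y); last by rewrite -scalemxAl yx scaler0.
  rewrite !dotE mulrA -invfM -expr2 sqr_sqrtr ?ltW ?dot_gt0//.
  by rewrite mulVf// gt_eqF// dot_gt0.
have xy : dot x y = 0.
  have : K * dot x y = 0.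
    by rewrite -dotZl -ex mul_Dmx dot_N_skew yx linear0 oppr0.
  by move/eqP; rewrite mulf_eq0 (negPf K0) => /eqP.
(* The generalised kernel of Dmx y has dimension 1, so it is spanned by x,
   which is orthogonal to y; but y has a component in it. *)
have [r0' rK' rNK'] := chi_root y y1.
have [p [p0 pb pp]] := spectral_idempotent r0'.
have xp : x *m horner_mx (Dmx y) p = x.
  rewrite (@horner_mx_eigenvector _ _ _ _ 0) ?p0 ?scale1r//.
  by rewrite mul_Dmx yx scale0r.
have rk1 : \rank (horner_mx (Dmx y) p) = 1%N.
  have := mxtrace_idempotent pp; rewrite trpD// p0 !pb ?oppr_eq0//.
  by rewrite addr0 mulr0 addr0 => /eqP; rewrite eq_sym pnatr_eq1 => /eqP.
have /eqmxP xE : (x == horner_mx (Dmx y) p)%MS.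
  by rewrite -(mxrank_leqif_eq _) ?rk1 ?rank_rV ?x0// -xp submxMl.
have : (y *m horner_mx (Dmx y) p <= x)%MS by rewrite xE submxMl.
case/sub_rVP => a ya; have := congr1 (fun z : 'rV_n.+1 => dot z y) ya.
rewrite /= dotZl xy mulr0 => /eqP; apply/negP.
have -> : dot (y *m horner_mx (Dmx y) p) y = p.[0] * dot y y.
  rewrite /dot -mulmxA; elim/poly_ind: (p) => [|q c IH].
    by rewrite rmorph0 mul0mx mulmx0 horner0 mul0r mxE.
  rewrite rmorphD rmorphM /= horner_mx_X horner_mx_C mulmxDl -mulmxA Dmx_tr.
  rewrite mulmx0 add0r mul_scalar_mx -scalemxAr mxE.
  by rewrite hornerMXaddC mulr0 add0r.
by rewrite p0 y1 mulr1 oner_eq0.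
Qed.

End Unimodular.

(** [mxtrace_Dmx_pow] with j = 0 exhibits tr D_(nabla_x v) as a symmetric
    function of x and v. *)
Lemma bracket_dual_mean_curvature (x v : 'rV_n.+1) : \tr (Dmx (br x v)) = 0.
Proof.
have := mxtrace_Dmx_pow x v 0; have := mxtrace_Dmx_pow v x 0.
rewrite !expr1 !expr0 !mulr1 !mulmx1 mxtrace_mulC (dotC x v) /br !raddfB /=.
by move=> -> /eqP; rewrite (inj_eq (addIr _)) => /eqP ->; rewrite subrr.
Qed.

(** The vector that represents tr ad is not 0 by [unimodular_dim0], and it is
    orthogonal to all brackets by [bracket_dual_mean_curvature]. *)
Lemma mean_curvature_direction : (0 < n)%N -> exists2 w : 'rV[R]_n.+1,
  dot w w = 1 & forall x y : 'rV_n.+1, dot (br x y) w = 0.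
Proof.
move=> n0; pose H : 'rV[R]_n.+1 := \row_i \tr (Dmx 'e_i).
have HE v : dot v H = \tr (Dmx v).
  rewrite [in RHS](row_sum_delta v) linear_sum raddf_sum /dot mxE.
  by apply: eq_bigr => i _; rewrite !mxE linearZ /= mxtraceZ.
have H0 : H != 0.
  apply: contraTneq n0 => H0; rewrite unimodular_dim0// => v.
  by rewrite -HE H0 linear0.
exists ((Num.sqrt (dot H H))^-1 *: H) => [|x y].
  rewrite !dotE mulrA -invfM -expr2 sqr_sqrtr ?ltW ?dot_gt0//.
  by rewrite mulVf// gt_eqF// dot_gt0.
by rewrite dotZr (HE (br x y)) bracket_dual_mean_curvature mulr0.
Qed.

Section MeanCurvatureDirection.
Variable w : 'rV[R]_n.+1.
Hypotheses (w1 : dot w w = 1) (brw0 : forall x y, dot (br x y) w = 0).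
Let D := Dmx w.
Let P : 'M[R]_n.+1 := 1%:M - w^T *m w.

(** D is the shape operator of the subgroup with Lie algebra the orthogonal
    of w; it is symmetric because this orthogonal is an ideal. *)
Lemma shape_sym : D^T = D.
Proof.
apply/esym/mulmx_inj => x; apply/eqP; rewrite -subr_eq0 -dot_eq0.
apply/eqP; set y := _ - _.
rewrite {1}/y dotBl [X in _ - X]dot_mul trmxK [X in X - _]dotC.
by have := brw0 x y; rewrite /br dotBl !dot_N_skew -!mul_Dmx -/D; lra.
Qed.

Lemma shape_w : w *m D = 0.
Proof. by apply: trmx_inj; rewrite trmx_mul shape_sym Dmx_tr trmx0. Qed.

Let wN z : w *m N z = z *m D.
Proof. by rewrite mul_Dmx. Qed.

Lemma shape_proj : (D *m P = D) * (P *m D = D).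
Proof.
rewrite /P mulmxBr mulmx1 mulmxA Dmx_tr mul0mx subr0.
by rewrite mulmxBl mul1mx -mulmxA shape_w mulmx0 subr0.
Qed.

Lemma P_tr : P^T = P.
Proof. by rewrite /P linearB /= trmx1 trmx_mul trmxK. Qed.

Lemma mul_P x : x *m P = x - dot x w *: w.
Proof. by rewrite /P mulmxBr mulmx1 mul_outer. Qed.

Lemma dot_mul_P x y : dot (x *m P) y = dot x y - dot x w * dot y w.
Proof. by rewrite mul_P dotBl dotZl (dotC w). Qed.

(** F = D^2 - K^2 P is the commutator of N w and D, by [N_Dmx_commutator] at
    x = v = w, and it commutes with D; hence tr F^2 = 0, with F symmetric. *)
Lemma shape_sqr : D *m D = K ^+ 2 *: P.
Proof.
apply/eqP; rewrite -subr_eq0; apply/eqP; set F := _ - _.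
have FE : F = N w *m D - D *m N w.
  rewrite N_Dmx_commutator w1 -mul_Dmx shape_w linear0 subr0 /F /P.
  by rewrite -scalerN opprB.
have FT : F^T = F by rewrite /F linearB linearZ /= trmx_mul shape_sym P_tr.
have FD : F *m D = D *m F.
  by rewrite /F mulmxBl mulmxBr -scalemxAl -scalemxAr mulmxA !shape_proj.
apply: mxtrace_mulT_eq0; rewrite FT [X in _ *m X]FE mulmxBr raddfB /=.
rewrite mulmxA mxtrace_mulC mulmxA -FD -mulmxA [X in _ - X](_ : _ = \tr (F *m D *m N w)).
  by rewrite mulmxA subrr.
by rewrite mulmxA.
Qed.

Section Eigenvectors.
Variable k : R.
Hypothesis k2 : k ^+ 2 = K ^+ 2.

Let k0 : k != 0.
Proof. by rewrite -sqrf_eq0 k2 sqrf_eq0 gt_eqF. Qed.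

Lemma shape_eigen_w (x : 'rV_n.+1) : x *m D = k *: x -> dot x w = 0.
Proof.
move=> xD; have : k * dot x w = 0.
  by rewrite -dotZl -xD dot_mul shape_sym shape_w linear0.
by move/eqP; rewrite mulf_eq0 (negPf k0) => /eqP.
Qed.

Lemma shape_eigen_perp (x y : 'rV_n.+1) :
  x *m D = k *: x -> y *m D = - k *: y -> dot x y = 0.
Proof.
move=> xD yD; have := dot_mul D x y; rewrite shape_sym xD yD !dotE => E.
have : 2 * k * dot x y = 0 by lra.
by move/eqP; rewrite !mulf_eq0 pnatr_eq0 (negPf k0) => /eqP.
Qed.

(** nabla_x, for x in one eigenspace, preserves the other one. The vector c
    below is at the same time (D + k) a and (D - k) b, with a = nabla_x y and
    b = nabla_y x; as D^2 = k^2 on a and b, both D c = k c and D c = - k c. *)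
Lemma shape_eigen_N (x y : 'rV_n.+1) :
  x *m D = k *: x -> y *m D = - k *: y ->
  y *m N x *m D = - k *: (y *m N x).
Proof.
move=> xD yD; have xy := shape_eigen_perp xD yD.
have xw := shape_eigen_w xD.
have yw : dot y w = 0.
  have : k * dot y w = 0.
    apply: oppr_inj; rewrite -mulNr -dotZl -yD dot_mul shape_sym shape_w.
    by rewrite linear0 oppr0.
  by move/eqP; rewrite mulf_eq0 (negPf k0) => /eqP.
have := congr1 (mulmx w) (N_curvature x y).
rewrite /br -scalemxAr mulmxBr mulmxBr mulmxBr !mul_outer !(dotC w) xw yw.
rewrite !scale0r subrr scaler0 !mulmxA !wN xD yD -!scalemxAl mulmxBl.
have aw : dot (y *m N x) w = 0.
  by rewrite dot_N_skew wN xD dotZr (dotC y) xy mulr0 oppr0.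
have bw : dot (x *m N y) w = 0.
  by rewrite dot_N_skew wN yD dotZr xy mulr0 oppr0.
have D2 (z : 'rV_n.+1) : dot z w = 0 -> z *m D *m D = k ^+ 2 *: z.
  by move=> zw; rewrite -mulmxA shape_sqr -scalemxAr mul_P zw scale0r subr0 k2.
move: (y *m N x) (x *m N y) (D2 _ aw) (D2 _ bw) => a b aDD bDD E.
pose c := a *m D + k *: a.
have cE : c = b *m D - k *: b.
  apply/eqP; rewrite -subr_eq0 -[X in _ == X]E /c; apply/eqP.
  move: (a *m D) (b *m D) => a' b'; apply/rowP => j; rewrite !mxE; ring.
have cD : c *m D = k *: c.
  rewrite /c mulmxDl -scalemxAl aDD; move: (a *m D) => a'.
  by apply/rowP => j; rewrite !mxE; ring.
have : c *m D = - k *: c.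
  rewrite cE mulmxBl -scalemxAl bDD; move: (b *m D) => b'.
  by apply/rowP => j; rewrite !mxE; ring.
rewrite cD scaleNr => /eqP; rewrite -addr_eq0 -scalerDl scaler_eq0.
rewrite -mulr2n mulrn_eq0 (negPf k0) /= => /eqP; rewrite /c scaleNr => /eqP.
by rewrite addr_eq0 => /eqP.
Qed.

End Eigenvectors.

(** nabla_x x has no component in the eigenspace of - k: pair it with such a
    vector y and use that nabla_x y is again orthogonal to x. *)
Lemma shape_eigen_self k (x : 'rV_n.+1) : k ^+ 2 = K ^+ 2 -> x *m D = k *: x ->
  x *m N x *m D = k *: (x *m N x *m P).
Proof.
move=> k2 xD; set a := x *m N x.
have Nk2 : (- k) ^+ 2 = K ^+ 2 by rewrite sqrrN.
pose q := a *m D - k *: (a *m P).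
have qD : q *m D = - k *: q.
  rewrite /q mulmxBl -scalemxAl -(mulmxA a D D) -(mulmxA a P D).
  rewrite shape_proj shape_sqr -k2 -scalemxAr.
  move: (a *m D) (a *m P) => b c; apply/rowP => j; rewrite !mxE; ring.
have qw := shape_eigen_w Nk2 qD.
have aq : dot a q = 0.
  rewrite dot_N_skew; apply/eqP; rewrite oppr_eq0; apply/eqP.
  by apply: (shape_eigen_perp k2 xD); rewrite (shape_eigen_N k2 xD qD).
apply/eqP; rewrite -subr_eq0 -/q -dot_eq0 {1}/q dotBl dot_mul shape_sym qD.
by rewrite dotZr dotZl dot_mul_P aq qw !(mulr0, subrr).
Qed.

(** For eigenvectors x and y of both kinds all terms of <K(x,y)x, y> vanish,
    except - <nabla_x x, nabla_y y>. By [shape_eigen_self] only the components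
    of nabla_x x and nabla_y y along w contribute to it, which gives
    K^2 |x|^2 |y|^2, while the curvature hypothesis gives the opposite. *)
Lemma shape_eigen_mixed (x y : 'rV_n.+1) :
  x *m D = K *: x -> y *m D = - K *: y -> x = 0 \/ y = 0.
Proof.
move=> xD yD; have NK2 : (- K) ^+ 2 = K ^+ 2 by rewrite sqrrN.
have NND (z : 'rV_n.+1) : z *m D = K *: z -> z *m D = - - K *: z by rewrite opprK.
have xNyD (z t : 'rV_n.+1) : z *m D = K *: z -> t *m D = - K *: t ->
    z *m N t *m D = K *: (z *m N t).
  by move=> /NND zD tD; rewrite (shape_eigen_N NK2 tD zD) opprK.
have perp := @shape_eigen_perp K erefl.
have K22 : 2 * K ^+ 2 != 0 by rewrite mulf_neq0 ?pnatr_eq0// expf_neq0// gt_eqF.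
have xy := perp _ _ xD yD.
have aD := shape_eigen_self erefl xD; have bD := shape_eigen_self NK2 yD.
have ab : dot (x *m N x) (y *m N y) = - (K ^+ 2 * dot x x * dot y y).
  have aw : dot (x *m N x) w = - (K * dot x x).
    by rewrite dot_N_skew wN xD dotZr.
  have bw : dot (y *m N y) w = K * dot y y.
    by rewrite dot_N_skew wN yD dotZr; lra.
  move: aD bD aw bw; move: (x *m N x) (y *m N y) => a b aD bD aw bw.
  have PE : dot (a *m D) (b *m D) = K ^+ 2 * dot (a *m P) b.
    by rewrite dot_mul shape_sym -mulmxA shape_sqr -scalemxAr dotZr dot_mul P_tr.
  have PE' : dot (a *m D) (b *m D) = - K ^+ 2 * dot (a *m P) b.
    by rewrite aD bD !dotE !mul_P !dotE w1 (dotC w b); ring.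
  have : 2 * K ^+ 2 * dot (a *m P) b = 0 by lra.
  move/eqP; rewrite mulf_eq0 (negPf K22) dot_mul_P aw bw => /eqP E; lra.
have := congr1 (fun A => dot (x *m A) y) (N_curvature x y).
rewrite !mulmxBr -scalemxAr !mulmxBr !mul_outer [N (_ - _)]linearB mulmxBr.
rewrite !mulmxA !dotE xy.
rewrite mul0r sub0r.
have xNNy (z : 'rV_n.+1) : z *m D = K *: z -> dot (x *m N z) y = 0.
  by move=> zD; rewrite dot_N_skew perp ?oppr0// (shape_eigen_N erefl zD yD).
have xNNy' (z : 'rV_n.+1) : z *m D = - K *: z -> dot (x *m N z) y = 0.
  by move=> zD; rewrite perp// xNyD.
have yNxD := shape_eigen_N erefl xD yD; have xNyD' := xNyD _ _ xD yD.
rewrite xNNy'// xNNy// (dot_N_skew x (x *m N y)) perp//.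
rewrite (dot_N_skew y (x *m N x)) ab => E.
have : 2 * K ^+ 2 * (dot x x * dot y y) = 0 by lra.
move/eqP; rewrite mulf_eq0 (negPf K22) mulf_eq0 !dot_eq0 /=.
by case/orP => /eqP ->; [left|right].
Qed.

Lemma shape_scalar : D = K *: P \/ D = - K *: P.
Proof.
pose Q k (z : 'rV_n.+1) := z *m (D + k *: P).
have QD k z : k ^+ 2 = K ^+ 2 -> Q k z *m D = k *: Q k z.
  move=> k2; rewrite /Q -mulmxA scalemxAr; congr (z *m _).
  by rewrite mulmxDl -scalemxAl shape_proj shape_sqr -k2 [in RHS]scalerDr scalerA -expr2 addrC.
have QE k : (forall z, Q k z = 0) -> D = - k *: P.
  move=> Q0; apply/eqP; rewrite scaleNr -addr_eq0; apply/eqP/mulmx_inj => z.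
  by rewrite mulmx0 -[RHS](Q0 z).
have [Q0|] := pselect (forall z, Q K z = 0); first by right; apply: QE.
move=> /existsNP[x /eqP x0]; left; rewrite -(opprK K); apply: QE => y.
have NK2 : (- K) ^+ 2 = K ^+ 2 by rewrite sqrrN.
have [xQ0|//] := shape_eigen_mixed (QD K x erefl) (QD (- K) y NK2).
by rewrite xQ0 eqxx in x0.
Qed.

End MeanCurvatureDirection.

(** In the hyperboloid model the null vector (w, 1) is an eigenvector of the
    whole algebra: the group fixes a point at infinity. *)
Lemma invariant_horosphere : (0 < n)%N -> exists2 w : 'rV[R]_n.+1,
  dot w w = 1 & forall x, w *m N x = - K *: (x - dot x w *: w).
Proof.
move=> n0; have [w w1 brw0] := mean_curvature_direction n0.
have [DE|DE] := shape_scalar w1 brw0.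
- exists (- w); rewrite ?dotE ?opprK// => x.
  by rewrite mulNmx -mul_Dmx DE -scalemxAr mul_P !dotE !scaleNr scalerN opprK.
by exists w => // x; rewrite -mul_Dmx DE -scalemxAr mul_P.
Qed.

(** The rank-two part x^T w - w^T x moves w as [invariant_horosphere]
    prescribes, so its complement A x fixes w. *)
Lemma horosphere_rotation (w : 'rV[R]_n.+1) : dot w w = 1 ->
  (forall x, w *m N x = - K *: (x - dot x w *: w)) ->
  exists A : {linear 'rV[R]_n.+1 -> 'M[R]_n.+1},
  [/\ forall x, (A x)^T = - A x, forall x, w *m A x = 0 &
      forall x, N x = A x + K *: (x^T *m w - w^T *m x)].
Proof.
move=> w1 wN; pose A0 (x : 'rV_n.+1) := N x - K *: (x^T *m w - w^T *m x).
have A0lin : linear A0.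
  move=> a x y; rewrite /A0 2!linearP /= mulmxDl mulmxDr -scalemxAl -scalemxAr.
  move: (N x) (N y) (x^T *m w) (w^T *m x) (y^T *m w) (w^T *m y) => *.
  by apply/matrixP => i j; rewrite !mxE; ring.
pose A : {linear 'rV_n.+1 -> 'M[R]_n.+1} :=
  HB.pack A0 (GRing.isLinear.Build _ _ _ _ _ A0lin).
exists A; split => x; rewrite /A /= /A0.
- rewrite linearB /= linearZ linearB /= !trmx_mul !trmxK N_skew.
  move: (N x) (w^T *m x) (x^T *m w) => a b c.
  by apply/matrixP => i j; rewrite !mxE; ring.
- rewrite mulmxBr -scalemxAr mulmxBr !mul_outer w1 scale1r wN (dotC w).
  by apply/rowP => i; rewrite !mxE; ring.
- by rewrite subrK.
Qed.

Section HorosphereRotation.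
Variables (w : 'rV[R]_n.+1) (A : {linear 'rV[R]_n.+1 -> 'M[R]_n.+1}).
Hypothesis w1 : dot w w = 1.
Hypothesis A_skew : forall x, (A x)^T = - A x.
Hypothesis wA : forall x, w *m A x = 0.
Hypothesis NE : forall x, N x = A x + K *: (x^T *m w - w^T *m x).

Let A_wT x : A x *m w^T = 0.
Proof.
by apply: trmx_inj; rewrite trmx_mul A_skew trmxK mulmxN wA oppr0 trmx0.
Qed.

(** The curvature equation for the pair (x, w), in terms of A. *)
Lemma rotation_commutator (x : 'rV_n.+1) : dot x w = 0 ->
  A x *m A w - A w *m A x = K *: A x + A (x *m A w).
Proof.
move=> xw; have Nw : N w = A w by rewrite NE subrr scaler0 addr0.
have brE : br x w = - (K *: x + x *m A w).
  rewrite /br Nw NE mulmxDr wA -scalemxAr mulmxBr !mul_outer w1 (dotC w) xw.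
  by rewrite scale0r scale1r sub0r add0r scalerN opprD.
have := N_curvature x w; rewrite Nw brE (NE x) (NE (- _)).
move: (A w) (A_wT w) (A_skew w) (wA w) => S Sw Sk wS.
rewrite [A (- _)]linearN [A (_ + _)]linearD [A (_ *: _)]linearZ /=.
rewrite [(- _)^T]linearN /= [(_ + _)^T]linearD /= [(_ *: _)^T]linearZ /=.
rewrite trmx_mul Sk.
rewrite !(mulmxDl, mulmxDr, mulmxBl, mulmxBr, =^~ scalemxAl, =^~ scalemxAr, mulNmx, mulmxN).
rewrite !mulmxA Sw -(mulmxA x^T) wS !mul0mx mulmx0.
move: (A x *m S) (S *m A x) (A x) (A (x *m S)) => a b c d.
move: (x^T *m w) (w^T *m x) (S *m x^T *m w) (w^T *m x *m S) => e f g h E.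
apply/matrixP => i j; have := congr1 (fun M : 'M[R]_n.+1 => M i j) E.
rewrite !mxE; move: (a i j) (b i j) (c i j) (d i j) (e i j) (f i j) (g i j) (h i j).
by move=> *; lra.
Qed.

(** [rotation_commutator] multiplied by A x and traced gives
    tr (A x A (x S)) = K |A x|^2 with S = A w. The left side is a symmetric
    form in x and x S, so its sum over an orthonormal basis vanishes because S
    is skew; therefore A vanishes on the orthogonal of w. *)
Lemma rotation_collinear x : A x = dot x w *: A w.
Proof.
pose P : 'M[R]_n.+1 := 1%:M - w^T *m w.
have mul_P (z : 'rV_n.+1) : z *m P = z - dot z w *: w.
  by rewrite mulmxBr mulmx1 mul_outer.
have AP_S (z : 'rV_n.+1) : z *m P *m A w = z *m A w *m P.
  by rewrite !mul_P mulmxBl -scalemxAl wA scaler0 /dot -mulmxA A_wT mulmx0 mxE scale0r.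
pose G : 'M[R]_n.+1 := \matrix_(i, j) \tr (A ('e_i *m P) *m A ('e_j *m P)).
have G_sym : G^T = G by apply/matrixP => i j; rewrite !mxE mxtrace_mulC.
have trSG : \tr (A w *m G) = 0.
  have : \tr (A w *m G) = - \tr (A w *m G).
    by rewrite -{1}mxtrace_tr trmx_mul A_skew G_sym mulmxN raddfN mxtrace_mulC.
  by move=> ?; lra.
have sumE : \sum_i \tr (A ('e_i *m P) *m A ('e_i *m P *m A w)) = \tr (A w *m G).
  rewrite {2}/mxtrace; apply: eq_bigr => i _; rewrite mxE AP_S.
  rewrite [in LHS](row_sum_delta ('e_i *m A w)) mulmx_suml linear_sum mulmx_sumr.
  rewrite raddf_sum /=; apply: eq_bigr => j _; rewrite -scalemxAl linearZ /=.
  by rewrite -scalemxAr mxtraceZ [G j i]mxE mxtrace_mulC -!rowE mxE.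
have trE (z : 'rV_n.+1) : \tr (A (z *m P) *m A (z *m P *m A w)) =
    K * \tr (A (z *m P) *m (A (z *m P))^T).
  have zw : dot (z *m P) w = 0 by rewrite mul_P dotBl dotZl w1 mulr1 subrr.
  have := rotation_commutator zw; rewrite A_skew; move: (A (z *m P)) => B.
  move: (A (_ *m A w)) => C; move: (A w) => S /(congr1 (fun M => \tr (B *m M))) /=.
  rewrite mulmxBr mulmxDr raddfB raddfD /= -scalemxAr mxtraceZ.
  rewrite (mxtrace_mulC B (S *m B)) mulmxA -mulmxA -[S *m B *m B]mulmxA.
  rewrite (mxtrace_mulC S) mulmxA subrr mulmxN raddfN mulrN => ?; lra.
have AP0 (z : 'rV_n.+1) : A (z *m P) = 0.
  rewrite (row_sum_delta z) mulmx_suml linear_sum big1// => i _.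
  rewrite -scalemxAl linearZ /=; suff -> : A ('e_i *m P) = 0 by rewrite scaler0.
  apply: mxtrace_mulT_eq0; move: i.
  have : \sum_i \tr (A ('e_i *m P) *m (A ('e_i *m P))^T) = 0.
    apply: (mulfI (lt0r_neq0 K_gt0)); rewrite mulr0 mulr_sumr -[RHS]trSG -sumE.
    by apply: eq_bigr => i _; rewrite trE.
  move/eqP; rewrite psumr_eq0; last by move=> *; exact: mxtrace_mulT_ge0.
  by move=> /allP E i; apply/eqP/E/mem_index_enum.
by have := AP0 x; rewrite mul_P linearB linearZ /= => /eqP; rewrite subr_eq0 => /eqP.
Qed.

End HorosphereRotation.

Lemma bracket_special : exists (w : 'rV[R]_n.+1) (S : 'M[R]_n.+1),
  [/\ dot w w = 1, S^T = - S, w *m S = 0 &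
   forall x y, br x y = dot x w *: (y *m S + K *: y) - dot y w *: (x *m S + K *: x)].
Proof.
case: (posnP n) => [n0|n_gt0].
  have i0 (i : 'I_n.+1) : i = 0.
    by apply/val_inj; case: i => m /=; rewrite n0; case: m.
  have N0 x : N x = 0.
    apply/matrixP => i j; rewrite (i0 i) (i0 j).
    have := congr1 (fun A : 'M[R]_n.+1 => A 0 0) (N_skew x); rewrite !mxE => ?; lra.
  have dot_e0 (x : 'rV_n.+1) : dot x 'e_0 = x 0 0.
    by rewrite /dot trmx_delta -colE mxE.
  exists 'e_0, 0; split; rewrite ?dot_e0 ?mulmx0 ?trmx0 ?oppr0 ?mxE ?eqxx//.
  move=> x y; rewrite /br !N0 !mulmx0 subr0 !add0r !dot_e0.
  by apply/rowP => i; rewrite (i0 i) !mxE; ring.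
have [w w1 wN] := invariant_horosphere n_gt0.
have [A [A_skew wA NE]] := horosphere_rotation w1 wN.
exists w, (A w); split => // x y.
rewrite /br !NE !(rotation_collinear w1 A_skew wA NE x) (rotation_collinear w1 A_skew wA NE y).
rewrite !mulmxDr -!scalemxAr !mulmxBr !mul_outer (dotC y x).
by apply/rowP => i; rewrite !mxE; ring.
Qed.

End NegativeCurvature.

(** * Symmetric forms and orthonormal bases *)

Section SymmetricForm.
Context {R : fieldType} {g : lmodType R} (form : {symmetric g}).

Lemma metricC x y : form x y = form y x.
Proof. by rewrite hermC expr0 mul1r. Qed.
Lemma metricDl x y z : form (x + y) z = form x z + form y z.
Proof. exact: linearDl. Qed.
Lemma metricDr x y z : form z (x + y) = form z x + form z y.
Proof. exact: linearDr. Qed.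
Lemma metricBl x y z : form (x - y) z = form x z - form y z.
Proof. exact: linearBl. Qed.
Lemma metricBr x y z : form z (x - y) = form z x - form z y.
Proof. exact: linearBr. Qed.
Lemma metricNl x z : form (- x) z = - form x z.
Proof. exact: linearNl. Qed.
Lemma metricNr x z : form z (- x) = - form z x.
Proof. exact: linearNr. Qed.
Lemma metricZl a x z : form (a *: x) z = a * form x z.
Proof. exact: linearZl_LR. Qed.
Lemma metricZr a x z : form z (a *: x) = a * form z x.
Proof. by rewrite metricC metricZl metricC. Qed.
Lemma metric0l z : form 0 z = 0.
Proof. exact: linear0l. Qed.
Lemma metric_suml I (r : seq I) (F : I -> g) z :
  form (\sum_(i <- r) F i) z = \sum_(i <- r) form (F i) z.
Proof.
by apply: (big_morph (form^~ z)) => [x y|]; [exact: metricDl|exact: metric0l].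
Qed.
Definition metricE := (metricDl, metricDr, metricBl, metricBr, metricNl,
  metricNr, metricZl, metricZr).

End SymmetricForm.

Section Orthonormal.
Context {R : realType} {g : vectType R} (form : {symmetric g}).
Hypothesis form_pos : positive_definite form.

(** Gram-Schmidt; only the values of b below k matter. *)
Lemma orthonormal_family k : (k <= \dim {:g})%N -> exists b : nat -> g,
  forall i j, (i < k)%N -> (j < k)%N -> form (b i) (b j) = (i == j)%:R.
Proof.
elim: k => [|k IH] kd; first by exists (fun=> 0).
have [b bE] := IH (ltnW kd).
pose V := <<[seq b i | i <- iota 0 k]>>%VS.
have [x xV] : exists x, x \notin V.
  have : ~~ ({:g} <= V)%VS.
    apply: contraL kd => /dimvS dV; rewrite -leqNgt (leq_trans dV)//.
    by rewrite (leq_trans (dim_span _))// size_map size_iota.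
  by case/subvPn => x _ xV; exists x.
pose y := x - \sum_(i < k) form x (b i) *: b i.
have y0 : y != 0.
  apply: contra xV; rewrite subr_eq0 => /eqP ->; apply: memv_suml => i _.
  by rewrite memvZ// memv_span// map_f// mem_iota/=.
have yb j : (j < k)%N -> form y (b j) = 0.
  move=> jk; rewrite metricBl metric_suml (bigD1 (Ordinal jk))//= metricZl bE// eqxx.
  rewrite mulr1 big1 ?addr0 ?subrr// => i ij; rewrite metricZl bE//.
  by rewrite -[val i == j]/(i == Ordinal jk) (negPf ij) mulr0.
pose c := (Num.sqrt (form y y))^-1.
have cy : form (c *: y) (c *: y) = 1.
  rewrite metricZl metricZr mulrA -invfM -expr2 sqr_sqrtr ?ltW ?form_pos//.
  by rewrite mulVf// gt_eqF// form_pos.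
exists (fun i => if i == k then c *: y else b i) => i j.
rewrite !ltnS (leq_eqVlt i) (leq_eqVlt j); case: (eqVneq i k) => [-> _|ik /= ltik].
  case: (eqVneq j k) => [-> _|jk /= ltjk]; first by rewrite cy.
  by rewrite metricZl yb// mulr0.
case: (eqVneq j k) => [-> _|jk /= ltjk]; last exact: bE.
by rewrite metricC metricZl yb// mulr0 (negPf ik).
Qed.

Lemma orthonormal_basis : exists b : 'I_(\dim {:g}) -> g,
  (forall i j, form (b i) (b j) = (i == j)%:R) /\
  forall x, x = \sum_i form x (b i) *: b i.
Proof.
have [b bE] := orthonormal_family (leqnn _).
exists b; split=> [i j|x]; first exact: bE.
pose X := [tuple b i | i < \dim {:g}].
have XE (i : 'I_(\dim {:g})) : X`_i = b i by rewrite -tnth_nth tnth_mktuple.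
have coefE (a : 'I_(\dim {:g}) -> R) (j : 'I_(\dim {:g})) : form (\sum_i a i *: X`_i) (b j) = a j.
  rewrite metric_suml (bigD1 j)//= XE metricZl bE// eqxx mulr1 big1 ?addr0// => i ij.
  by rewrite XE metricZl bE// -[val i == j]/(i == j) (negPf ij) mulr0.
have freeX : free X.
  by apply/freeP => a a0 i; rewrite -(coefE a) a0 metric0l.
have basX : basis_of fullv X.
  by rewrite basisEfree freeX subvf size_tuple leqnn.
have := coord_basis basX (memvf x) => xE.
rewrite {1}xE; apply: eq_bigr => i _; rewrite XE; congr (_ *: _).
by rewrite -[LHS](coefE (fun j => coord X j x)) -xE.
Qed.

End Orthonormal.

(** * Riemannian Lie algebras of constant negative curvature *)
Section NegativeCurvatureAlgebra.
Context {R : realType} {g : vectType R} (br nabla : g -> g -> g).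
Variables (form : {symmetric g}) (k : R).
Hypotheses (form_pos : positive_definite form).
Hypotheses (LC : is_levi_civita br form nabla) (k_lt0 : k < 0).
Hypothesis curv : constant_curvature br form nabla k.

(** [bracket_special] transported by the coordinates of an orthonormal
    basis. *)
Lemma negative_curvature_special : (0 < \dim {:g})%N ->
  exists (B : 'End(g)) (u : g) (lambda : R),
  [/\ skew_symmetric form B, form u u != 0, B u = 0, lambda != 0 &
   forall x y, br x y = special_bracket form u (B + lambda *: \1%VF) x y].
Proof.
have [b []] := orthonormal_basis form_pos.
case: (\dim {:g}) b => // n b bE bD _.
have [nabl nabr tors metr] := LC.
pose toR x : 'rV[R]_n.+1 := \row_i form x (b i).
pose toG (v : 'rV[R]_n.+1) := \sum_i v 0 i *: b i.
have toRK x : toG (toR x) = x.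
  by rewrite [RHS]bD; apply: eq_bigr => i _; rewrite mxE.
have toGE v i : form (toG v) (b i) = v 0 i.
  rewrite metric_suml (bigD1 i)//= metricZl bE eqxx mulr1 big1 ?addr0// => j ji.
  by rewrite metricZl bE (negPf ji) mulr0.
have toGK v : toR (toG v) = v by apply/rowP => i; rewrite mxE toGE.
have toG_lin : linear toG.
  move=> a v w; rewrite /toG scaler_sumr -big_split; apply: eq_bigr => i _ /=.
  by rewrite !mxE scalerDl scalerA.
have toR_lin : linear toR.
  by move=> a x y; apply/rowP => i; rewrite !mxE metricDl metricZl.
pose toGL : {linear 'rV[R]_n.+1 -> g} :=
  HB.pack toG (GRing.isLinear.Build _ _ _ _ _ toG_lin).
pose toRL : {linear g -> 'rV[R]_n.+1} :=
  HB.pack toR (GRing.isLinear.Build _ _ _ _ _ toR_lin).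
have dotE' x y : dot (toR x) (toR y) = form x y.
  rewrite {2}(bD x) metric_suml /dot mxE; apply: eq_bigr => i _.
  by rewrite !mxE metricZl (metricC _ y).
pose N0 v : 'M[R]_n.+1 := \matrix_(i, j) form (nabla (toG v) (b i)) (b j).
have N0_lin : linear N0.
  move=> a v w; apply/matrixP => i j; rewrite !mxE toG_lin.
  by rewrite nabl metricDl metricZl.
pose N : {linear 'rV[R]_n.+1 -> 'M[R]_n.+1} :=
  HB.pack N0 (GRing.isLinear.Build _ _ _ _ _ N0_lin).
have nablaE x y : toR (nabla x y) = toR y *m N (toR x).
  pose nx : {linear g -> g} := HB.pack (nabla x)
    (GRing.isLinear.Build _ _ _ _ _ (nabr x)).
  rewrite -[LHS]/(toRL (nx y)) {1}(bD y) !linear_sum.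
  apply/rowP => j; rewrite summxE mxE; apply: eq_bigr => i _.
  by rewrite 2!linearZ /= !mxE toRK.
have brE x y : toR (br x y) = toR y *m N (toR x) - toR x *m N (toR y).
  by rewrite -tors -[LHS]/(toRL _) linearB /= !nablaE.
have N_skew v : (N v)^T = - N v.
  apply/matrixP => i j; rewrite !mxE; apply/eqP; rewrite -addr_eq0.
  by rewrite (metricC _ _ (b i)) addrC (metricC _ _ (b j)) addrC (metricC _ _ (nabla _ (b i))) addrC metr.
have K0 : 0 < Num.sqrt (- k) by rewrite sqrtr_gt0 oppr_gt0.
have curvN x y : N (y *m N x - x *m N y) - (N y *m N x - N x *m N y)
    = Num.sqrt (- k) ^+ 2 *: (y^T *m x - x^T *m y).
  rewrite sqr_sqrtr ?oppr_ge0 1?ltW//; apply: mulmx_inj => z.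
  rewrite !(mulmxBr, =^~ scalemxAr) !mul_outer !mulmxA.
  rewrite -(toGK x) -(toGK y) -(toGK z) -brE -!nablaE !dotE'.
  have := congr1 toRL (curv (toG x) (toG y) (toG z)).
  rewrite /curvature /wedge_op !(linearB, linearZ) /= => ->.
  rewrite !(metricC _ (toG z)).
  by apply/rowP => i; rewrite !mxE; ring.
have [w [S [w1 S_skew wS brS]]] := bracket_special N_skew curvN K0.
pose B0 x := toGL (toRL x *m S).
have B0_lin : linear B0.
  by move=> a x y; rewrite /B0 linearP mulmxDl -scalemxAl linearP.
pose BL : {linear g -> g} := HB.pack B0 (GRing.isLinear.Build _ _ _ _ _ B0_lin).
have BE x : linfun BL x = toG (toR x *m S) by rewrite lfunE.
exists (linfun BL), (toG w), (Num.sqrt (- k)); split.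
- move=> x y; rewrite !BE -!dotE' !toGK dot_mul S_skew mulmxN; exact: dotNr.
- by rewrite -dotE' toGK w1 oner_eq0.
- by rewrite BE toGK wS -[LHS]/(toGL 0) linear0.
- by rewrite gt_eqF.
move=> x y; rewrite -[LHS]toRK brE brS /special_bracket.
rewrite !add_lfunE !scale_lfunE !id_lfunE !BE -!dotE' toGK -[LHS]/(toGL _).
have toGS v z : toG (v + Num.sqrt (- k) *: toR z) = toG v + Num.sqrt (- k) *: z.
  by rewrite -[LHS]/(toGL _) linearD linearZ /= toRK.
rewrite linearB [toGL (_ *: (_ *m S + _ *: toR y))]linearZ.
by rewrite [toGL (_ *: (_ *m S + _ *: toR x))]linearZ /= !toGS.
Qed.

End NegativeCurvatureAlgebra.

(** * The Levi-Civita product of a special bracket *)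
(** Linear identities in a vector space become ring identities after the
    application of a generic linear form. *)
Lemma linear_form_ext (R : fieldType) (V : vectType R) (x y : V) :
  (forall l : V -> R, (forall a v, l (a *: v) = a * l v) ->
    (forall v w, l (v + w) = l v + l w) -> (forall v, l (- v) = - l v) -> l 0 = 0 ->
    l x = l y) -> x = y.
Proof.
move=> lxy; rewrite (coord_vbasis (memvf x)) (coord_vbasis (memvf y)).
apply: eq_bigr => i _; congr (_ *: _).
by apply: lxy => *; rewrite ?linearZ ?linearD ?linearN ?linear0.
Qed.

Section SpecialBracket.
Context {R : realType} {g : vectType R}.
Variables (form : {symmetric g}) (B : 'End(g)) (u : g) (lambda : R).
Hypotheses (form_nd : nondegenerate form) (B_skew : skew_symmetric form B).
Hypotheses (Bu : B u = 0).
Let br := special_bracket form u (B + lambda *: \1%VF).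

Definition special_nabla x y : g :=
  form x u *: B y + lambda *: (form x y *: u - form y u *: x).
Local Notation nabla := special_nabla.

Lemma form_B_u x : form (B x) u = 0.
Proof. by rewrite B_skew Bu metricC metric0l oppr0. Qed.

Lemma special_bracketE x y : br x y =
  form x u *: (B y + lambda *: y) - form y u *: (B x + lambda *: x).
Proof. by rewrite /br /special_bracket !(add_lfunE, scale_lfunE, id_lfunE). Qed.

Lemma form_special_bracket_u x y : form (br x y) u = 0.
Proof. by rewrite special_bracketE !metricE !form_B_u; ring. Qed.

Let BD x y : B (x + y) = B x + B y. Proof. exact: linearD. Qed.
Let BN x : B (- x) = - B x. Proof. exact: linearN. Qed.
Let BZ a x : B (a *: x) = a *: B x. Proof. exact: linearZ. Qed.

Lemma special_bracket_lie : is_lie_bracket br.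
Proof.
split.
- move=> y a x x'; apply: linear_form_ext => l lZ lD lN l0.
  by rewrite !special_bracketE !metricE ?(BD, BZ) !(lZ, lD, lN); ring.
- move=> y a x x'; apply: linear_form_ext => l lZ lD lN l0.
  by rewrite !special_bracketE !metricE ?(BD, BZ) !(lZ, lD, lN); ring.
- by move=> x; rewrite special_bracketE subrr.
move=> x y z; apply: linear_form_ext => l lZ lD lN l0.
rewrite ![br _ (br _ _)]special_bracketE !form_special_bracket_u.
rewrite !special_bracketE !(BD, BZ, BN) !(lZ, lD, lN, BD, BZ, BN) l0; ring.
Qed.

Lemma special_levi_civita : is_levi_civita br form nabla.
Proof.
split.
- move=> y a x x'; apply: linear_form_ext => l lZ lD lN l0.
  by rewrite /nabla !metricE ?BD ?BZ !(lZ, lD, lN); ring.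
- move=> y a x x'; apply: linear_form_ext => l lZ lD lN l0.
  by rewrite /nabla !metricE ?BD ?BZ !(lZ, lD, lN); ring.
- move=> x y; rewrite special_bracketE; apply: linear_form_ext => l lZ lD lN l0.
  by rewrite /nabla !(lZ, lD, lN) (metricC _ y x); ring.
move=> x y z; rewrite /nabla !metricE (B_skew y) (metricC _ u z) (metricC _ y x).
ring.
Qed.

Lemma special_constant_curvature :
  constant_curvature br form nabla (- form u u * lambda ^+ 2).
Proof.
move=> x y z; apply: linear_form_ext => l lZ lD lN l0.
rewrite /curvature /wedge_op {1}/nabla form_special_bracket_u.
rewrite special_bracketE /nabla !metricE !form_B_u.
rewrite !(BD, BZ, BN, Bu) !(lZ, lD, lN) l0.
have -> : form (B x) z = - form x (B z) by rewrite B_skew.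
have -> : form (B y) z = - form y (B z) by rewrite B_skew.
rewrite (metricC _ z u) (metricC _ y x).
ring.
Qed.

Lemma special_pseudo_euclidean : pseudo_euclidean_lie_algebra br form.
Proof. by split; last exact: special_bracket_lie. Qed.

Lemma form_special_nabla_u x : form (nabla x x) u =
   lambda * (form x x * form u u - form x u ^+ 2).
Proof. by rewrite /nabla !metricE form_B_u; ring. Qed.

End SpecialBracket.

(** * Geodesics and their first integrals *)
Section Derivatives.
Context {R : realType}.

Lemma is_derive_mxP m n (y : R -> 'M[R]_(m, n)) (t : R) d :
  is_derive t 1 y d <-> forall i j, is_derive t 1 (fun s => y s i j) (d i j).
Proof.
split=> [[yt <-] i j|yt].
  have ytij := (derivable_mxP y t 1).1 yt i j.
  by rewrite derive_mx// mxE; apply: derivableP.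
have yt1 : derivable y t 1 by apply/derivable_mxP => i j; case: (yt i j).
apply: DeriveDef => //; rewrite derive_mx//; apply/matrixP => i j; rewrite mxE.
by case: (yt i j).
Qed.

Lemma is_derive_linear_form n (l : 'rV[R]_n -> R) (y : R -> 'rV[R]_n) (t : R) d :
  linear_for *%R l -> is_derive t 1 y d -> is_derive t 1 (l \o y) (l d).
Proof.
move=> llin /is_derive_mxP yt.
pose L : {linear 'rV[R]_n -> R^o} :=
  HB.pack l (GRing.isLinear.Build _ _ _ _ _ llin).
have lE v : l v = \sum_i v 0 i * l 'e_i.
  rewrite {1}(row_sum_delta v) -[LHS]/(L _) linear_sum.
  by apply: eq_bigr => i _; rewrite linearZ.
rewrite lE (_ : l \o y = \sum_i (fun s => y s 0 i * l 'e_i)); last first.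
  by apply/funext => s; rewrite /= lE fct_sumE.
have h i : is_derive t 1 (fun s => y s 0 i * l 'e_i) (d 0 i * l 'e_i).
  have := yt 0 i => yti.
  have := is_deriveM yti (is_derive_cst (l 'e_i) t 1).
  by rewrite scaler0 add0r [_ *: _]mulrC.
exact: is_derive_sum.
Qed.

Lemma is_derive_bilinear_form n (b : 'rV[R]_n -> 'rV[R]_n -> R)
    (y : R -> 'rV[R]_n) (t : R) d :
  (forall v, linear_for *%R (b v)) -> (forall v, linear_for *%R (b^~ v)) ->
  is_derive t 1 y d ->
  is_derive t 1 (fun s => b (y s) (y s)) (b d (y t) + b (y t) d).
Proof.
move=> blinr blinl yt.
have bE v w : b v w = \sum_i v 0 i * b 'e_i w.
  pose L : {linear 'rV[R]_n -> R^o} :=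
    HB.pack (b^~ w) (GRing.isLinear.Build _ _ _ _ _ (blinl w)).
  rewrite {1}(row_sum_delta v) -[LHS]/(L _) linear_sum.
  by apply: eq_bigr => i _; rewrite linearZ.
rewrite !bE -big_split /=.
rewrite (_ : (fun s => _) = \sum_i (fun s => y s 0 i * b 'e_i (y s))); last first.
  by apply/funext => s; rewrite bE fct_sumE.
apply: is_derive_sum => i.
have yti := (is_derive_mxP _ _ _).1 yt 0 i.
have byi := is_derive_linear_form (blinr 'e_i) yt.
by have := is_deriveM yti byi; rewrite addrC /= [b _ _ *: _]mulrC.
Qed.

End Derivatives.

Section Geodesics.
Context {R : realType} {g : vectType R} {n : nat}.
Variables (form : {symmetric g}) (br nabla : g -> g -> g).
Variables (theta : {linear g -> 'rV[R]_n}).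
Hypotheses (theta_bij : bijective theta).
Hypothesis LC : is_levi_civita br form nabla.

Lemma theta_inv : exists2 theta' : {linear 'rV[R]_n -> g},
  cancel theta theta' & cancel theta' theta.
Proof.
have [theta1 thK th1K] := theta_bij.
have th1_lin : linear theta1.
  by move=> a v w; apply: (can_inj thK); rewrite linearP !th1K.
exists (HB.pack theta1 (GRing.isLinear.Build _ _ _ _ _ th1_lin) :
  {linear 'rV[R]_n -> g}) => //.
Qed.

Variable x : R -> g.
Hypothesis geo : forall t : R,
  is_derive t 1 (theta \o x) (- theta (nabla (x t) (x t))).

Lemma geodesic_linear_form (l : {linear g -> R^o}) (t : R) :
  is_derive t 1 (l \o x) (- l (nabla (x t) (x t))).
Proof.
have [theta1 thK th1K] := theta_inv.
have l1lin : linear_for *%R (l \o theta1).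
  by move=> a v w /=; rewrite !linearP.
have := is_derive_linear_form l1lin (geo t).
rewrite (_ : _ \o (_ \o _) = l \o x); last by apply/funext => s /=; rewrite thK.
by rewrite /= !linearN thK.
Qed.

(** nabla_x is skew, so the derivative - 2 <nabla_x x, x> vanishes. *)
Lemma geodesic_energy s t : form (x s) (x s) = form (x t) (x t).
Proof.
have [theta1 thK th1K] := theta_inv.
pose b v w := form (theta1 v) (theta1 w).
have blr v : linear_for *%R (b v).
  by move=> a w w'; rewrite /b linearP metricDr metricZr.
have bll v : linear_for *%R (b^~ v).
  by move=> a w w'; rewrite /b linearP metricDl metricZl.
apply: (is_derive_0_is_cst (f := fun t => form (x t) (x t))) => r.
have := is_derive_bilinear_form blr bll (geo r); rewrite /b /=.
rewrite (_ : (fun s => _) = (fun t => form (x t) (x t))); last first.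
  by apply/funext => ?; rewrite thK.
rewrite linearN !thK metricNl metricNr (metricC _ (x r)) -opprD.
have := levi_civita_metric LC (x r) (x r) (x r); rewrite (metricC _ (x r)).
by move=> ->; rewrite oppr0.
Qed.

End Geodesics.

(** * Incompleteness in the indefinite case *)

(** The function atan (a / sqrt c) would have the constant nonzero derivative
    lambda sqrt c, hence take values further apart than pi. *)
Lemma no_global_riccati (R : realType) (a : R -> R) (lambda c : R) :
  lambda != 0 -> 0 < c ->
  ~ (forall t : R, is_derive t 1 a (lambda * (a t ^+ 2 + c))).
Proof.
move=> l0 c0 da; pose r := Num.sqrt c.
have r0 : 0 < r by rewrite sqrtr_gt0.
have r2 : r ^+ 2 = c by rewrite sqr_sqrtr// ltW.
pose phi t := atan (r^-1 * a t) - lambda * r * t.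
have dphi (t : R) : is_derive t 1 phi 0.
  have d1 : is_derive t 1 (fun s => r^-1 * a s) (r^-1 * (lambda * (a t ^+ 2 + c))).
    exact: is_deriveZ.
  have d2 := @is_derive1_comp _ atan (fun s => r^-1 * a s) t _ _
    (is_derive1_atan _) d1.
  have d3 : is_derive t 1 (fun s => lambda * r * s) (lambda * r * 1).
    exact: is_deriveZ.
  have := is_deriveB d2 d3.
  set d := (X in is_derive _ _ _ X); have -> // : d = 0.
  rewrite /d -r2.
  by field; rewrite !gt_eqF// ltr_pwDl ?exprn_gt0 ?sqr_ge0.
have phiE (t : R) : atan (r^-1 * a t) = lambda * r * t + phi 0.
  by rewrite -(is_derive_0_is_cst t 0 dphi) /phi; ring.
pose T := pi / (lambda * r).
have := phiE T; have := phiE 0.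
have := atan_gtNpi2 (r^-1 * a T); have := atan_ltpi2 (r^-1 * a T).
have := atan_gtNpi2 (r^-1 * a 0); have := atan_ltpi2 (r^-1 * a 0).
have -> : lambda * r * T = pi.
  by rewrite mulrC divfK// mulf_neq0// gt_eqF.
by move=> *; lra.
Qed.

Section Completeness.
Context {R : realType} {g : vectType R}.
Variables (form : {symmetric g}) (B : 'End(g)) (u : g) (lambda : R).
Hypotheses (form_nd : nondegenerate form) (B_skew : skew_symmetric form B).
Hypotheses (u0 : form u u != 0) (lambda0 : lambda != 0) (Bu : B u = 0).
Let br := special_bracket form u (B + lambda *: \1%VF).
Let nabla := special_nabla form B u lambda.

(** Otherwise the form, up to the sign of <u,u>, is semidefinite; a
    semidefinite form vanishes only on its radical, so it is definite. *)
Lemma opposite_sign_vector : ~ positive_definite form ->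
  ~ negative_definite form -> exists w, form w w * form u u < 0.
Proof.
move=> npos nneg; apply: contrapT => /forallNP wu.
have psi_ge0 w : 0 <= form w w * form u u by rewrite leNgt; apply/negP.
have psi0 w : form w w = 0 -> w = 0.
  move=> ww; apply/eqP; rewrite -memv0 -(eqP form_nd).
  apply/mem_orthovP => z _; apply: contrapT => /eqP wz.
  (* The two values at which the affine function s |-> <z + s w, z + s w> is
     - 1 and 1. *)
  pose t := - (form z z + 1) / (2 * form w z).
  pose t' := - (form z z - 1) / (2 * form w z).
  have tE s : form (z + s *: w) (z + s *: w) = form z z + 2 * s * form w z.
    by rewrite !metricE ww (metricC _ z w); ring.
  have := psi_ge0 (z + t *: w); have := psi_ge0 (z + t' *: w).
  have -> : form (z + t *: w) (z + t *: w) = -1.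
    by rewrite tE /t; field.
  have -> : form (z + t' *: w) (z + t' *: w) = 1.
    by rewrite tE /t'; field.
  by rewrite mul1r mulN1r => h1 h2; move: u0; rewrite neq_lt; lra.
have [uneg|upos|/eqP] := ltgtP (form u u) 0; last by rewrite (negPf u0).
- apply: nneg => w w0; rewrite lt_neqAle.
  apply/andP; split; first by apply: contra w0 => /eqP /psi0 ->.
  by have := psi_ge0 w; rewrite nmulr_lge0.
- apply: npos => w w0; rewrite lt_neqAle eq_sym.
  apply/andP; split; first by apply: contra w0 => /eqP /psi0 ->.
  by have := psi_ge0 w; rewrite pmulr_lge0.
Qed.

(** By [form_special_nabla_u], a = <x,u> solves a Riccati equation along every
    geodesic; the geodesic starting at a vector of [opposite_sign_vector]
    cannot be complete. *)
Lemma complete_definite n (G : lieGroupType R n) (c : chart R n G)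
    (theta : {linear g -> 'rV[R]_n}) : bijective theta ->
  geodesically_complete c theta nabla ->
  positive_definite form \/ negative_definite form.
Proof.
move=> theta_bij compl; apply: contrapT => /not_orP[npos nneg].
have [w w0] := opposite_sign_vector npos nneg.
have [gamma [x [[_ geo] _ xw]]] := compl 1%g w.
have LC : is_levi_civita br form nabla by exact: special_levi_civita.
pose l : {linear g -> R^o} := HB.pack (form^~ u)
  (GRing.isLinear.Build R g R^o _ (form^~ u)
     (fun a y z => etrans (metricDl form _ _ _) (congr1 (+%R^~ _) (metricZl form _ _ _)))).
apply: (@no_global_riccati _ (l \o x) lambda (- (form w w * form u u))) => //.
  by rewrite oppr_gt0.
move=> t; have := geodesic_linear_form theta_bij geo l t.
rewrite /= form_special_nabla_u// (geodesic_energy theta_bij LC geo t 0) xw.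
set d := (X in is_derive _ _ _ X); set d' := (X in _ -> is_derive _ _ _ X).
by have -> // : d = d'; rewrite /d /d'; ring.
Qed.

End Completeness.

(** * Global solutions of ordinary differential equations *)
Section VectorValuedCurves.
Context {R : realType}.

Lemma is_derive_continuous (V : normedModType R) (f : R -> V) (t : R) d :
  is_derive t 1 f d -> {for t, continuous f}.
Proof.
by move=> [ft _]; apply/differentiable_continuous/derivable1_diffP.
Qed.

Lemma rV_norm_le n (v : 'rV[R]_n) e : 0 <= e ->
  (forall i, `|v 0 i| <= e) -> `|v| <= e.
Proof.
move=> e0 ve; rewrite /Num.Def.normr/= mx_normrE (bigmax_le _ e0)//= => -[i j] _.
by rewrite (ord1 i).
Qed.

Lemma rV_coord_le n (v : 'rV[R]_n) i : `|v 0 i| <= `|v|.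
Proof.
rewrite [leRHS]/Num.Def.normr/= mx_normrE.
exact: (le_bigmax _ (fun ij : 'I_1 * 'I_n => `|v ij.1 ij.2|) (0, i)).
Qed.

Lemma rV_continuousP n (f : R -> 'rV[R]_n) (t : R) :
  {for t, continuous f} <-> forall i, {for t, continuous (fun s => f s 0 i)}.
Proof.
split=> [ft i|ft].
  apply/cvgrPdist_le => e e0; have /cvgrPdist_le/(_ e e0) := ft.
  apply: filterS => s; apply: le_trans.
  by have := rV_coord_le (f t - f s) i; rewrite !mxE.
apply/cvgrPdist_le => e e0.
have fe i : \forall s \near t, `|f t 0 i - f s 0 i| <= e.
  by have /cvgrPdist_le/(_ e e0) := ft i.
apply: filterS (@filter_forall _ _ _ _ _ fe) => s fes.
by apply: rV_norm_le (ltW e0) _ => i; rewrite !mxE.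
Qed.

(** The integral from - m has the right derivative on the interval of radius
    m; subtracting its value at 0 makes it independent of m. *)
Lemma primitive_exists (f : R -> R) : continuous f ->
  exists2 h : R -> R, h 0 = 0 & forall t : R, is_derive t 1 h (f t).
Proof.
move=> fc; pose mu := @lebesgue_measure R.
pose P (m t : R) := \int[mu]_(s in `[- m, t]) f s.
have fint (a b : R) : mu.-integrable `[a, b] (EFin \o f).
  apply: continuous_compact_integrable; first exact: segment_compact.
  exact: continuous_subspaceT.
pose h t := if 0 <= t then \int[mu]_(s in `]0, t]) f s
            else - \int[mu]_(s in `]t, 0]) f s.
have hE (m t : R) : `|t| < m -> h t = P m t - P m 0.
  rewrite ltr_norml => /andP[tm mt]; rewrite /h /P; case: ifPn => [t0|].
    by rewrite Rintegral_itvB ?bnd_simp//; lra.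
  rewrite -ltNge => t0; rewrite -[RHS]opprB Rintegral_itvB ?bnd_simp//; lra.
exists h; first by rewrite /h lexx set_itvoc0 Rintegral_set0.
move=> t; pose m : R := `|t| + 1.
have mt : - m < t by rewrite /m; have := ler_norm (- t); rewrite normrN; lra.
have [dP PE] : derivable (P m) t 1 /\ derive1 (P m) t = f t.
  apply: (@continuous_FTC1 _ f (BLeft (- m)) t (t + 1)); [by rewrite ltrDl|exact: fint| |exact: fc].
    by rewrite lte_fin.
have dPm : is_derive t 1 (fun s => P m s - P m 0) (f t).
  have := is_deriveB (derivableP dP) (is_derive_cst (P m 0) t 1).
  by rewrite subr0 -derive1E PE.
apply: near_eq_is_derive dPm.
have : \forall s \near t, `|s| < m.
  have /cvgrPdist_lt/(_ 1 ltr01) : {for t, continuous (fun s : R => s)} by [].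
  apply: filterS => s; rewrite /m => ts.
  by have := ler_normB t (t - s); rewrite subKr; lra.
by apply: filterS => s /hE.
Qed.

Lemma rV_primitive_exists n (f : R -> 'rV[R]_n) : continuous f ->
  exists2 h : R -> 'rV[R]_n, h 0 = 0 & forall t : R, is_derive t 1 h (f t).
Proof.
move=> fc.
have /choice[h hP] : forall i, exists h : R -> R,
    h 0 = 0 /\ forall t : R, is_derive t 1 h (f t 0 i).
  move=> i; have [|h h0 hd] := @primitive_exists (fun t => f t 0 i).
    by move=> t; apply: (rV_continuousP _ _).1 i; exact: fc.
  by exists h.
exists (fun t => \row_i h i t).
  by apply/rowP => i; rewrite !mxE; case: (hP i).
move=> t; apply/is_derive_mxP => i j; rewrite (ord1 i).
under eq_fun do rewrite mxE.
by case: (hP j).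
Qed.

Lemma nonneg_derive_le (h dh : R -> R) (t : R) : 0 <= t ->
  (forall s, 0 <= s -> s <= t -> is_derive s 1 h (dh s)) ->
  (forall s, 0 <= s -> s <= t -> 0 <= dh s) -> h 0 <= h t.
Proof.
move=> t0 hd dh0; have [||c] := @MVT_segment R h dh 0 t t0.
- by move=> s; rewrite in_itv/= => /andP[s0 st]; apply: hd; exact: ltW.
- apply: continuous_in_subspaceT => s.
  rewrite inE/= in_itv/= => /andP[s0 st]; exact/is_derive_continuous/hd.
rewrite in_itv/= => /andP[c0 ct] E; rewrite -subr_ge0 E.
by rewrite mulr_ge0 ?dh0// subr0.
Qed.

(** The weight exp (K |t|) is what makes the Picard operator a contraction on
    the whole line. *)
Lemma expR_growth n (h dh : R -> 'rV[R]_n) (C K : R) : 0 <= C -> 0 < K ->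
  h 0 = 0 -> (forall t : R, is_derive t 1 h (dh t)) ->
  (forall t : R, `|dh t| <= C * expR (K * `|t|)) ->
  forall t, `|h t| <= C / K * expR (K * `|t|).
Proof.
move=> C0 K0 h0 hd dhC t.
have key (h1 dh1 : R -> R) (t1 : R) : 0 <= t1 -> h1 0 = 0 ->
    (forall s : R, is_derive s 1 h1 (dh1 s)) ->
    (forall s, `|dh1 s| <= C * expR (K * `|s|)) ->
    h1 t1 <= C / K * expR (K * t1).
  move=> t10 h10 hd1 dhC1; pose f s := C / K * expR (K * s) - h1 s.
  have : f 0 <= f t1.
    apply: (@nonneg_derive_le f (fun s => C * expR (K * s) - dh1 s)) => //.
      move=> s _ _.
      have d1 : is_derive s 1 (fun s => K * s) (K * 1) by exact: is_deriveZ.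
      have d2 := @is_derive1_comp _ expR (fun s => K * s) s _ _
        (is_derive_expR _) d1.
      have d3 : is_derive s 1 (fun s => C / K * expR (K * s))
          (C / K * (expR (K * s) * (K * 1))) by exact: is_deriveZ.
      have := is_deriveB d3 (hd1 s).
      set d := (X in is_derive _ _ _ X); set d' := (X in _ -> is_derive _ _ _ X).
      by have -> // : d = d'; rewrite /d /d'; field; rewrite gt_eqF.
    move=> s s0 _; rewrite subr_ge0; have := dhC1 s; rewrite (ger0_norm s0).
    exact: le_trans (ler_norm _).
  rewrite /f mulr0 expR0 mulr1 h10 subr0 => fle; rewrite -subr_ge0; apply: le_trans fle.
  by rewrite divr_ge0// ltW.
have key2 (h1 dh1 : R -> R) (t1 : R) : 0 <= t1 -> h1 0 = 0 ->
    (forall s : R, is_derive s 1 h1 (dh1 s)) ->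
    (forall s, `|dh1 s| <= C * expR (K * `|s|)) ->
    `|h1 t1| <= C / K * expR (K * t1).
  move=> t10 h10 hd1 dhC1; rewrite ler_norml (key h1 dh1)// andbT lerNl.
  apply: (key (fun s => - h1 s) (fun s => - dh1 s)) => //.
  - by rewrite h10 oppr0.
  - by move=> s; rewrite normrN.
apply: rV_norm_le => [|i]; first by rewrite mulr_ge0 ?expR_ge0// divr_ge0// ltW.
have hdi s := (is_derive_mxP h s (dh s)).1 (hd s) 0 i.
have dhCi s : `|dh s 0 i| <= C * expR (K * `|s|).
  exact: le_trans (rV_coord_le _ _) (dhC s).
have h0i : h 0 0 i = 0 by rewrite h0 mxE.
have [t0|t0] := leP 0 t.
  by rewrite (ger0_norm t0); apply: (key2 (fun s => h s 0 i) (fun s => dh s 0 i)).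
rewrite (ltr0_norm t0) -[t in `|h t _ _|]opprK.
apply: (key2 (fun s => h (- s) 0 i) (fun s => - dh (- s) 0 i)) => //.
- by rewrite oppr_ge0 ltW.
- by rewrite oppr0.
- move=> s; have := @is_derive1_comp _ (fun s => h s 0 i) -%R s _ _ (hdi (- s))
    (is_deriveNid s 1).
  set d := (X in is_derive _ _ _ X); set d' := (X in _ -> is_derive _ _ _ X).
  by have -> // : d = d'; rewrite /d /d'; ring.
- by move=> s; rewrite normrN -(normrN s).
Qed.

(** The bounds u k - 2 c / 2^k and u k + 2 c / 2^k are nested, so the limit
    comes with its rate of convergence. *)
Lemma geometric_limit_R (u : nat -> R) (c : R) :
  (forall k, `|u k.+1 - u k| <= c / 2 ^+ k) ->
  exists l, forall k, `|u k - l| <= 2 * c / 2 ^+ k.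
Proof.
move=> uc; pose e k : R := 2 * c / 2 ^+ k.
have eS k : e k - e k.+1 = c / 2 ^+ k.
  by rewrite /e exprS; field; rewrite expf_neq0// pnatr_eq0.
have c0 : 0 <= c by have := uc 0%N; rewrite expr0 divr1; exact: le_trans.
have e0 k : 0 <= e k by rewrite /e !mulr_ge0// invr_ge0 exprn_ge0.
have a_mono : {homo (fun k => u k - e k) : i j / (i <= j)%N >-> i <= j}.
  apply: homo_leq => [//|? ? ?|i]; first exact: le_trans.
  by have := uc i; rewrite -eS ler_norml => /andP[? ?]; lra.
have b_mono : {homo (fun k => - (u k + e k)) : i j / (i <= j)%N >-> i <= j}.
  apply: homo_leq => [//|? ? ?|i]; first exact: le_trans.
  by have := uc i; rewrite -eS ler_norml => /andP[? ?]; lra.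
have ab i j : u i - e i <= u j + e j.
  have := a_mono _ _ (leq_maxl i j); have := b_mono _ _ (leq_maxr i j).
  by have := e0 (maxn i j) => /= *; lra.
pose A := [set u k - e k | k in setT].
exists (sup A) => k; rewrite -/(e k) ler_norml.
have supA : has_sup A.
  by split; [exists (u 0%N - e 0%N), 0%N|exists (u k + e k) => _ [i _ <-]].
have h1 : u k - e k <= sup A by apply: sup_upper_bound => //; exists k.
have h2 : sup A <= u k + e k by apply: sup_le_ub; [case: supA|move=> _ [i _ <-]].
by lra.
Qed.

Lemma geometric_limit n (u : nat -> 'rV[R]_n) (c : R) : 0 <= c ->
  (forall k, `|u k.+1 - u k| <= c / 2 ^+ k) ->
  exists l, forall k, `|u k - l| <= 2 * c / 2 ^+ k.
Proof.
move=> c0 uc.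
have /choice[l lP] : forall i, exists l, forall k, `|u k 0 i - l| <= 2 * c / 2 ^+ k.
  move=> i; apply: geometric_limit_R => k.
  by have := le_trans (rV_coord_le _ i) (uc k); rewrite !mxE.
exists (\row_i l i) => k; apply: rV_norm_le => [|i]; last by rewrite !mxE.
by rewrite !mulr_ge0// invr_ge0 exprn_ge0.
Qed.

(** Global existence for a time-dependent vector field that is globally
    Lipschitz in space: the iterates Z of the integral operator satisfy
    |Z_(k+1) - Z_k| <= C 2^-k exp (2 L |t|). *)
Theorem picard n (F : R -> 'rV[R]_n -> 'rV[R]_n) (L M : R) (z0 : 'rV[R]_n) :
  0 < L -> (forall t z z', `|F t z - F t z'| <= L * `|z - z'|) ->
  (forall z, continuous (F^~ z)) -> (forall t, `|F t z0| <= M) ->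
  exists2 z : R -> 'rV[R]_n, z 0 = z0 &
    forall t : R, is_derive t 1 z (F t (z t)).
Proof.
move=> L0 FL Fc FM.
have M0 : 0 <= M by exact: le_trans (normr_ge0 _) (FM 0).
have FcL (z : R -> 'rV[R]_n) : continuous z -> continuous (fun t => F t (z t)).
  move=> zc t; apply/cvgrPdist_le => e e0.
  have e2 : 0 < e / 2 by rewrite divr_gt0.
  have /cvgrPdist_le/(_ _ e2) := Fc (z t) t.
  have e2L : 0 < e / 2 / L by rewrite divr_gt0.
  have /cvgrPdist_le/(_ _ e2L) := zc t.
  apply: filterS2 => s zs Fs.
  rewrite -(subrKA (F s (z t))) (le_trans (ler_normD _ _))// [leRHS]splitr lerD//.
  rewrite (le_trans (FL _ _ _))// mulrC -ler_pdivlMr//.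
have /choice[prim primP] : forall z : R -> 'rV[R]_n, exists w : R -> 'rV[R]_n,
    continuous z -> w 0 = z0 /\ forall t : R, is_derive t 1 w (F t (z t)).
  move=> z; have [/FcL zc|nzc] := pselect (continuous z); last by exists z.
  have [h h0 hd] := rV_primitive_exists zc.
  exists (fun t => z0 + h t) => _; split; first by rewrite h0 addr0.
  by move=> t; apply: is_derive_eq; rewrite add0r.
have prim_cont z : continuous z -> continuous (prim z).
  by move=> /primP[_ pd] t; exact: is_derive_continuous (pd t).
pose Z k := iter k prim (cst z0).
have Zc k : continuous (Z k).
  elim: k => [|k IH]; first by move=> t; exact: cvg_cst.
  exact: prim_cont.
pose C := M / (2 * L).
have C0 : 0 <= C by rewrite divr_ge0// mulr_ge0// ltW.
pose E (t : R) := expR (2 * L * `|t|).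
have E1 (t : R) : 1 <= E t by rewrite -expR0 ler_expR !mulr_ge0// ltW.
have L2 : 0 < 2 * L by rewrite mulr_gt0.
(* Two primitives of close curves are twice as close, in the weighted norm. *)
have contract (z z' : R -> 'rV[R]_n) c : 0 <= c -> continuous z -> continuous z' ->
    (forall t, `|z t - z' t| <= c * E t) ->
    forall t, `|prim z t - prim z' t| <= c / 2 * E t.
  move=> c0 zc zc' zz' t; have [w0 wd] := primP z zc; have [w0' wd'] := primP z' zc'.
  have -> : c / 2 = c * L / (2 * L) by field; rewrite gt_eqF.
  apply: (@expR_growth _ (fun t => prim z t - prim z' t)
    (fun t => F t (z t) - F t (z' t))) => //.
  - by rewrite mulr_ge0// ltW.
  - by rewrite w0 w0' subrr.
  - move=> s; rewrite (le_trans (FL _ _ _))// [c * L]mulrC.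
    by rewrite -(mulrA L c) ler_pM2l.
have ZS k t : `|Z k.+1 t - Z k t| <= C / 2 ^+ k * E t.
  elim: k t => [|k IH] t.
    rewrite expr0 divr1; have [w0 wd] := primP _ (Zc 0%N).
    apply: (@expR_growth _ (fun t => Z 1%N t - z0) (fun t => F t z0)) => //.
    - by rewrite [Z 1%N 0]w0 subrr.
    - by move=> s; apply: is_derive_eq; rewrite subr0.
    - by move=> s; apply: le_trans (FM s) _; exact: ler_peMr M0 (E1 s).
  have -> : C / 2 ^+ k.+1 = C / 2 ^+ k / 2 by rewrite exprSr invfM mulrA.
  by apply: (contract (Z k.+1) (Z k)) => //; rewrite divr_ge0// exprn_ge0.
have /choice[z zP] : forall t, exists l, forall k,
    `|Z k t - l| <= 2 * (C * E t) / 2 ^+ k.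
  move=> t; apply: geometric_limit => [|k].
    by rewrite mulr_ge0// (le_trans _ (E1 t)).
  by rewrite mulrAC ZS.
have pow2 (a e : R) : 0 < e -> exists k, a / 2 ^+ k <= e.
  move=> e0; exists (Num.bound `|a / e|).
  set k := Num.bound _; have ak : `|a / e| < k%:R by exact: archi_boundP.
  have k2 : k%:R <= 2 ^+ k :> R by rewrite -natrX ler_nat ltnW// ltn_expl.
  rewrite ler_pdivrMr ?exprn_gt0// mulrC -ler_pdivrMr//.
  exact: le_trans (le_trans (ler_norm _) (ltW ak)) k2.
have zc : continuous z.
  move=> t; apply/cvgrPdist_le => e e0.
  have e3 : 0 < e / 3 by rewrite divr_gt0.
  have [k kE] := pow2 (2 * (C * expR (2 * L * (`|t| + 1)))) _ e3.
  have kEs s : `|t - s| < 1 -> `|Z k s - z s| <= e / 3.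
    move=> ts; apply: le_trans (zP s k) (le_trans _ kE).
    rewrite ler_pM2r ?invr_gt0 ?exprn_gt0// ler_pM2l// ler_wpM2l// ler_expR.
    rewrite ler_pM2l//; have := ler_normB t (t - s); rewrite subKr; lra.
  have /cvgrPdist_le/(_ _ e3) := Zc k t.
  have /cvgrPdist_lt/(_ 1 ltr01) : {for t, continuous (fun s : R => s)} by [].
  apply: filterS2 => s ts Zs.
  have := kEs s ts; have := kEs t; rewrite subrr normr0 => /(_ ltr01) h1 h2.
  have -> : z t - z s = (z t - Z k t) + (Z k t - Z k s) + (Z k s - z s).
    by rewrite !subrKA.
  rewrite (le_trans (ler_normD _ _))//.
  have := ler_normD (z t - Z k t) (Z k t - Z k s); rewrite (distrC (z t)).
  by move=> *; lra.
have [w0 wd] := primP z zc.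
suff zw : z = prim z by exists z; [rewrite zw|move=> t; rewrite {1}zw].
apply/funext => t; apply/eqP; rewrite -subr_eq0 -normr_le0.
apply/ler_addgt0Pr => e e0; rewrite add0r.
have [k kE] := pow2 (3 * (C * E t)) _ e0.
have h1 := zP t k.+1.
have h2 : `|Z k.+1 t - prim z t| <= 2 * C / 2 ^+ k / 2 * E t.
  apply: contract => //; first by rewrite divr_ge0 ?exprn_ge0// mulr_ge0.
  by move=> s; apply: le_trans (zP s k) _; rewrite mulrA mulrAC.
rewrite -(subrKA (Z k.+1 t)); apply: le_trans (ler_normD _ _) _.
rewrite distrC; apply: le_trans (lerD h1 h2) _; apply: le_trans kE.
have -> : 2 * (C * E t) / 2 ^+ k.+1 = C * E t / 2 ^+ k.
  by rewrite exprS; field; rewrite expf_neq0// pnatr_eq0.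
have CE : 0 <= C * E t / 2 ^+ k.
  by rewrite divr_ge0 ?exprn_ge0// mulr_ge0// (le_trans _ (E1 t)).
have -> : 2 * C / 2 ^+ k / 2 * E t = C * E t / 2 ^+ k by field; rewrite expf_neq0.
have -> : 3 * (C * E t) / 2 ^+ k = 3 * (C * E t / 2 ^+ k) by rewrite !mulrA.
by lra.
Qed.
End VectorValuedCurves.

(** * Radial retraction, chain rule and Lipschitz bounds *)
Section RadialRetraction.
Context {R : realType} {V : normedModType R}.
Variable r : R.
Hypothesis r0 : 0 < r.

(** The retraction to the ball of radius r makes a locally Lipschitz vector
    field globally Lipschitz. It is radial rather than coordinatewise so that a
    quadratic field is multiplied by a scalar, which preserves the first
    integral <x,x>. *)
Definition radial (y : V) : V := (r / Num.max r `|y|) *: y.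

Let m_gt0 (y : V) : 0 < Num.max r `|y|.
Proof. by rewrite lt_max r0. Qed.

Lemma radial_norm (y : V) : `|radial y| <= r.
Proof.
rewrite normrZ ger0_norm; last by rewrite divr_ge0// ltW.
by rewrite mulrAC ler_pdivrMr// ler_wpM2l ?(ltW r0)// le_max lexx orbT.
Qed.

Lemma radial_id (y : V) : `|y| <= r -> radial y = y.
Proof.
by move=> yr; rewrite /radial max_l// divff ?scale1r// gt_eqF.
Qed.

Lemma radial_lipschitz (y z : V) : `|radial y - radial z| <= 2 * `|y - z|.
Proof.
have [my mz] := (m_gt0 y, m_gt0 z).
have -> : radial y - radial z = (r / Num.max r `|y|) *: (y - z) +
    ((Num.max r `|z| - Num.max r `|y|) / Num.max r `|y|) *: radial z.
  rewrite /radial scalerA scalerBr -addrA; congr (_ + _).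
  rewrite -!(scaleNr _ z) -scalerDl; congr (_ *: _); field.
  by rewrite !gt_eqF.
have h1 : `|(r / Num.max r `|y|) *: (y - z)| <= `|y - z|.
  rewrite normrZ ler_piMl// ger0_norm; last by rewrite divr_ge0// ltW.
  by rewrite ler_pdivrMr// mul1r le_max lexx.
have mm : `|Num.max r `|z| - Num.max r `|y| | <= `|y - z|.
  have h3 := ler_distD 0 y z; have := lerB_dist y z; have := lerB_dist z y.
  rewrite (distrC z) => a b; rewrite ler_norml; apply/andP.
  rewrite /Num.max; case: ifP; case: ifP => *; split; lra.
have h2 : `|((Num.max r `|z| - Num.max r `|y|) / Num.max r `|y|) *: radial z|
    <= `|y - z|.
  rewrite normrZ normrM -mulrA (le_trans _ mm)// ler_piMr//.
  rewrite normfV (gtr0_norm my) mulrC ler_pdivrMr// mul1r.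
  by rewrite (le_trans (radial_norm z))// le_max lexx.
by rewrite (le_trans (ler_normD _ _))//; lra.
Qed.

End RadialRetraction.

Section Curves.
Context {R : realType}.

Lemma is_derive_diff_comp (V W : normedModType R) (f : R -> V) (h : V -> W)
    (t : R) d : is_derive t 1 f d -> differentiable h (f t) ->
  is_derive t 1 (h \o f) ('d h (f t) d).
Proof.
move=> [ft fd] hd; have fdiff : differentiable f t by exact/derivable1_diffP.
have hf : differentiable (h \o f) t by exact: differentiable_comp.
apply: DeriveDef; first exact/derivable1_diffP.
by rewrite deriveE// diff_comp//= -fd deriveE.
Qed.

(** Two curves with the same value and the same derivative at t may be mixed
    in any way whatsoever; this is used to concatenate curves at t. *)
Lemma is_derive_if (V : normedModType R) (P : R -> bool) (f g : R -> V) (t : R) d :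
  f t = g t -> is_derive t 1 f d -> is_derive t 1 g d ->
  is_derive t 1 (fun s => if P s then f s else g s) d.
Proof.
move=> fg [fc fd] [gc gd].
have cv : (fun h => h^-1 *: ((fun s => if P s then f s else g s) (h *: 1 + t) -
    (if P t then f t else g t))) @ 0^' --> d.
  have := fc; rewrite /derivable => /cvg_ex[/= l fl]; have := gc.
  rewrite /derivable => /cvg_ex[/= l' gl'].
  have ld : l = d by rewrite -fd; apply/esym/cvg_lim.
  have l'd : l' = d by rewrite -gd; apply/esym/cvg_lim.
  move: fl gl'; rewrite ld l'd => /cvgrPdist_le fl /cvgrPdist_le gl.
  apply/cvgrPdist_le => e e0; near=> h.
  have -> : (if P t then f t else g t) = f t by rewrite -fg if_same.
  case: (P (h *: 1 + t)); first by near: h; exact: fl.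
  by rewrite fg; near: h; exact: gl.
apply: DeriveDef; first by apply/cvg_ex; exists d.
exact/cvg_lim.
Unshelve. all: by end_near. Qed.

Lemma continuous_if (T : topologicalType) (P : R -> bool) (f g : R -> T) (t : R) :
  f t = g t -> {for t, continuous f} -> {for t, continuous g} ->
  {for t, continuous (fun s => if P s then f s else g s)}.
Proof.
move=> fg fc gc A /=; have -> : (if P t then f t else g t) = f t.
  by rewrite -fg if_same.
move=> At; have fA := fc _ At; rewrite fg in At; have gA := gc _ At.
have {}fA : \forall s \near t, A (f s) by [].
have {}gA : \forall s \near t, A (g s) by [].
suff : \forall s \near t, A (if P s then f s else g s) by [].
by near=> s; case: (P s); near: s.
Unshelve. all: by end_near.
Qed.

Lemma is_derive_translate n (f : R -> 'rV[R]_n) (a t : R) d :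
  is_derive (t - a) 1 f d -> is_derive t 1 (fun s => f (s - a)) d.
Proof.
move=> /is_derive_mxP fd; apply/is_derive_mxP => i j.
have da : is_derive t 1 (fun s : R => s - a) 1.
  by have := is_deriveB (is_derive_id t 1) (is_derive_cst a t 1); rewrite subr0.
have := @is_derive1_comp _ (fun s => f s i j) (fun s => s - a) t _ _ (fd i j) da.
by rewrite mulr1.
Qed.

Lemma speed_le n (z dz : R -> 'rV[R]_n) (S t : R) : 0 <= S ->
  (forall s : R, is_derive s 1 z (dz s)) -> (forall s, `|dz s| <= S) ->
  `|z t - z 0| <= S * `|t|.
Proof.
move=> S0 zd zS; apply: rV_norm_le; first by rewrite mulr_ge0.
move=> i; rewrite !mxE.
have zdi s := (is_derive_mxP z s (dz s)).1 (zd s) 0 i.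
have dzS s : `|dz s 0 i| <= S by exact: le_trans (rV_coord_le _ _) (zS s).
have seg a b : a <= b -> `|z b 0 i - z a 0 i| <= S * (b - a).
  have zdi' x (_ : x \in `]a, b[) := zdi x.
  move=> ab; have [|c _ ->] := MVT_segment ab zdi'.
    by apply: continuous_subspaceT => s; exact: is_derive_continuous (zdi s).
  by rewrite normrM ler_pM// ger0_norm// subr_ge0.
have [t0|t0] := leP 0 t; first by rewrite (ger0_norm t0) -[t in S * t]subr0 seg.
by rewrite (ltr0_norm t0) distrC -(sub0r t) seg// ltW.
Qed.

Lemma diff_rV n (W : normedModType R) (f : 'rV[R]_n -> W) z v : differentiable f z ->
  'd f z v = \sum_i v 0 i *: 'D_'e_i f z.
Proof.
move=> fz; rewrite {1}(row_sum_delta v) linear_sum.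
by apply: eq_bigr => i _; rewrite linearZ deriveE.
Qed.

(** The mean value theorem on the segment from w to z, for each coordinate of
    f. *)
Lemma locally_lipschitz n m (f : 'rV[R]_n -> 'rV[R]_m) (e : 'rV[R]_n) :
  (\forall z \near e, differentiable f z) ->
  (forall i, {for e, continuous ('D_'e_i f)}) ->
  exists C : R, 0 <= C /\ exists2 r : R, 0 < r &
    forall z w, `|z - e| <= r -> `|w - e| <= r -> `|f z - f w| <= C * `|z - w|.
Proof.
move=> fdiff fcont; pose A i := `|'D_'e_i f e| + 1.
have bnd : \forall z \near e, differentiable f z /\ forall i, `|'D_'e_i f z| <= A i.
  have H i : \forall z \near e, `|'D_'e_i f z| <= A i.
    have /cvgrPdist_le/(_ 1 ltr01) := fcont i; apply: filterS => z fz.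
    rewrite -['D_'e_i f z](subKr ('D_'e_i f e)).
    by rewrite (le_trans (ler_normB _ _))// lerD2l.
  by apply: filterS2 fdiff (@filter_forall _ _ _ _ _ H) => z.
have /nbhs_ballP[r0 /= r00 ballr] := bnd.
exists (\sum_i A i); split; first by apply: sumr_ge0 => i _; rewrite addr_ge0.
exists (r0 / 2); first by rewrite divr_gt0.
move=> z w ze we.
pose p (s : R) := w + s *: (z - w).
have pball (s : R) : 0 <= s -> s <= 1 -> ball e r0 (p s).
  move=> s0 s1; rewrite -ball_normE /= distrC.
  have -> : p s - e = (1 - s) *: (w - e) + s *: (z - e).
    by rewrite /p; apply/rowP => i; rewrite !mxE; ring.
  rewrite (le_lt_trans (ler_normD _ _))// !normrZ (ger0_norm s0).
  rewrite ger0_norm ?subr_ge0//.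
  have : (1 - s) * `|w - e| <= (1 - s) * (r0 / 2) by rewrite ler_wpM2l// subr_ge0.
  have : s * `|z - e| <= s * (r0 / 2) by rewrite ler_wpM2l.
  by move=> *; nra.
have pd (s : R) : is_derive s 1 p (z - w).
  apply/is_derive_mxP => i j.
  rewrite (_ : (fun _ => _) = (fun s => w i j + (z - w) i j * s)); last first.
    by apply/funext => s'; rewrite /p !mxE; ring.
  have d1 : is_derive s 1 (fun s => (z - w) i j * s) ((z - w) i j * 1).
    exact: is_deriveZ.
  have := is_deriveD (is_derive_cst (w i j) s 1) d1.
  by rewrite add0r mulr1.
pose dfp (s : R) := 'd f (p s) (z - w).
have fpd (s : R) : 0 <= s -> s <= 1 -> is_derive s 1 (f \o p) (dfp s).
  by move=> s0 s1; apply: is_derive_diff_comp => //; case: (ballr _ (pball s s0 s1)).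
have dfp_le (s : R) : 0 <= s -> s <= 1 -> `|dfp s| <= \sum_i A i * `|z - w|.
  move=> s0 s1; have [fps Aps] := ballr _ (pball s s0 s1).
  rewrite /dfp diff_rV// (le_trans (ler_norm_sum _ _ _))// ler_sum// => i _.
  by rewrite normrZ mulrC ler_pM// rV_coord_le.
apply: rV_norm_le => [|i].
  by rewrite mulr_ge0// sumr_ge0// => i _; rewrite addr_ge0.
have [||s] := @MVT_segment R (fun s => (f \o p) s 0 i) (fun s => dfp s 0 i) 0 1 ler01.
- move=> s; rewrite in_itv/= => /andP[s0 s1].
  by apply: (is_derive_mxP _ _ _).1; apply: fpd; exact: ltW.
- apply: continuous_in_subspaceT => s; rewrite inE/= in_itv/= => /andP[s0 s1].
  have := (is_derive_mxP _ _ _).1 (fpd s s0 s1) 0 i; exact: is_derive_continuous.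
rewrite in_itv/= => /andP[s0 s1].
rewrite /= /p scale1r scale0r addr0 subr0 mulr1 (addrC w) subrK !mxE => ->.
by rewrite mulr_suml (le_trans (rV_coord_le _ _))// dfp_le.
Qed.

End Curves.

(** * The geodesic flow of a definite form *)
Section OppositeForm.
Context {R : realType} {g : vectType R} (form : {symmetric g}).

(** It has the same Levi-Civita product as the form, which reduces negative
    definite forms to positive definite ones. *)
Definition opp_form (x y : g) : R := - form x y.

Let opp_form_bilinear : bilinear_for (GRing.Scale.Law.clone _ _ ( *%R ) _)
  (GRing.Scale.Law.clone _ _ (idfun \; *%R) _) opp_form.
Proof.
split=> z a x y; rewrite /opp_form.
  by rewrite metricDl metricZl opprD /= mulrN.
by rewrite metricDr metricZr opprD /= mulrN.
Qed.
HB.instance Definition _ :=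
  bilinear_isBilinear.Build R g g R _ _ opp_form opp_form_bilinear.

Let opp_form_sym x y : opp_form x y = (-1) ^+ false * idfun (opp_form y x).
Proof. by rewrite expr0 mul1r /opp_form metricC. Qed.
HB.instance Definition _ :=
  isHermitianSesquilinear.Build R g false idfun opp_form opp_form_sym.

Lemma opp_form_positive : negative_definite form ->
  positive_definite (opp_form : {symmetric g}).
Proof. by move=> neg x /neg; rewrite /= oppr_gt0. Qed.

Lemma opp_form_levi_civita br nabla : is_levi_civita br form nabla ->
  is_levi_civita br (opp_form : {symmetric g}) nabla.
Proof.
case=> ? ? ? metr; split=> // x y z.
by rewrite /= /opp_form -opprD metr oppr0.
Qed.

End OppositeForm.

Section GeodesicFlow.
Context {R : realType} {g : vectType R} {n : nat}.
Variables (form : {symmetric g}) (br nabla : g -> g -> g).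
Variables (theta : {linear g -> 'rV[R]_n}).
Hypotheses (theta_bij : bijective theta).
Hypothesis LC : is_levi_civita br form nabla.

Lemma rV_bilinear_bounded (N : 'rV[R]_n -> 'rV[R]_n -> 'rV[R]_n) :
  (forall v, linear (N v)) -> (forall v, linear (N^~ v)) ->
  exists2 A : R, 0 <= A & forall v w, `|N v w| <= A * `|v| * `|w|.
Proof.
move=> Nr Nl; pose A := \sum_i \sum_j `|N 'e_i 'e_j|.
exists A => [|v w]; first by rewrite sumr_ge0// => i _; rewrite sumr_ge0.
pose NL w : {linear 'rV[R]_n -> 'rV[R]_n} :=
  HB.pack (N^~ w) (GRing.isLinear.Build _ _ _ _ _ (Nl w)).
pose NR v : {linear 'rV[R]_n -> 'rV[R]_n} :=
  HB.pack (N v) (GRing.isLinear.Build _ _ _ _ _ (Nr v)).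
have -> : N v w = \sum_i \sum_j (v 0 i * w 0 j) *: N 'e_i 'e_j.
  rewrite -[LHS]/(NL w v) {1}(row_sum_delta v) linear_sum.
  apply: eq_bigr => i _; rewrite linearZ /= -[N _ _]/(NR 'e_i w).
  rewrite {1}(row_sum_delta w) linear_sum scaler_sumr.
  by apply: eq_bigr => j _; rewrite linearZ /= scalerA.
rewrite -mulrA mulr_suml (le_trans (ler_norm_sum _ _ _))// ler_sum// => i _.
rewrite mulr_suml (le_trans (ler_norm_sum _ _ _))// ler_sum// => j _.
by rewrite normrZ normrM mulrC ler_wpM2l// ler_pM// rV_coord_le.
Qed.

Hypothesis form_pos : positive_definite form.

Lemma positive_definite_bound : exists2 C : R, 0 <= C &
  forall x, `|theta x| <= C * Num.sqrt (form x x).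
Proof.
have [b [bE bD]] := orthonormal_basis form_pos.
exists (\sum_i `|theta (b i)|) => [|x]; first by rewrite sumr_ge0.
rewrite {1}(bD x) linear_sum (le_trans (ler_norm_sum _ _ _))// mulr_suml.
apply: ler_sum => i _; rewrite linearZ normrZ mulrC ler_wpM2l//.
rewrite -sqrtr_sqr ler_wsqrtr//; rewrite [leRHS](_ : _ = \sum_i form x (b i) ^+ 2).
  by rewrite (bigD1 i)//= lerDl sumr_ge0// => j _; rewrite sqr_ge0.
rewrite {1}(bD x) metric_suml; apply: eq_bigr => j _.
by rewrite metricZl (metricC _ (b j)).
Qed.

(** The equation y' = - N (y, y) is solved with y replaced by its radial
    retraction on the right-hand side. This multiplies the field by a scalar, so
    <x,x> is still constant and bounds y by
    [positive_definite_bound], in the region where the retraction is the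
    identity. *)
Theorem geodesic_flow (v : g) : exists2 x : R -> g, x 0 = v &
  (forall t : R, is_derive t 1 (theta \o x) (- theta (nabla (x t) (x t)))) /\
  exists Y, forall t, `|theta (x t)| <= Y.
Proof.
have [nabl nabr tors metr] := LC.
have [th' thK th'K] := theta_inv theta_bij.
pose N a b := theta (nabla (th' a) (th' b)).
have Nr a : linear (N a) by move=> c b b'; rewrite /N linearP nabr linearP.
have Nl a : linear (N^~ a) by move=> c b b'; rewrite /N linearP nabl linearP.
have [A A0 NA] := rV_bilinear_bounded Nr Nl.
have [C C0 thC] := positive_definite_bound.
pose r := C * Num.sqrt (form v v) + 1.
have r0 : 0 < r by rewrite ltr_wpDl// mulr_ge0// sqrtr_ge0.
pose F (t : R) y := - N (radial r y) (radial r y).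
pose L := 4 * A * r + 1.
have L0 : 0 < L by rewrite ltr_wpDl// !mulr_ge0// ltW.
have FL t y z : `|F t y - F t z| <= L * `|y - z|.
  have NB a b c : N (a - b) c = N a c - N b c.
    pose NL : {linear 'rV[R]_n -> 'rV[R]_n} :=
      HB.pack (N^~ c) (GRing.isLinear.Build _ _ _ _ _ (Nl c)).
    by rewrite -[LHS]/(NL (a - b)) linearB.
  have NB' a b c : N a (b - c) = N a b - N a c.
    pose NR : {linear 'rV[R]_n -> 'rV[R]_n} :=
      HB.pack (N a) (GRing.isLinear.Build _ _ _ _ _ (Nr a)).
    by rewrite -[LHS]/(NR (b - c)) linearB.
  have -> : F t y - F t z = - (N (radial r y - radial r z) (radial r y)
      + N (radial r z) (radial r y - radial r z)).
    by rewrite /F NB NB' subrKA opprB opprK addrC.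
  rewrite normrN (le_trans (ler_normD _ _))//.
  have := NA (radial r y - radial r z) (radial r y).
  have := NA (radial r z) (radial r y - radial r z).
  have := radial_lipschitz r0 y z; move: `|y - z| (normr_ge0 (y - z)) => d d0.
  move: `|radial r y - _| (normr_ge0 (radial r y - radial r z)) => d' d'0 dd'.
  have h1 : A * `|radial r z| * d' <= A * r * (2 * d).
    by rewrite ler_pM ?mulr_ge0// ler_wpM2l// radial_norm.
  have h2 : A * d' * `|radial r y| <= A * (2 * d) * r.
    by rewrite ler_pM ?mulr_ge0//; [rewrite ler_wpM2l|rewrite radial_norm].
  by rewrite /L => *; lra.
have [||y y0 yd] := @picard _ _ F L (A * r * r) (theta v) L0 FL.
- by move=> z t; exact: cvg_cst.
- move=> t; rewrite normrN (le_trans (NA _ _))//.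
  by rewrite ler_pM ?mulr_ge0 ?radial_norm// ler_wpM2l// radial_norm.
pose b a a' := form (th' a) (th' a').
have blr a : linear_for *%R (b a).
  by move=> c w w'; rewrite /b linearP metricDr metricZr.
have bll a : linear_for *%R (b^~ a).
  by move=> c w w'; rewrite /b linearP metricDl metricZl.
have energy t : b (y t) (y t) = form v v.
  rewrite -(thK v) -y0.
  apply: (is_derive_0_is_cst (f := fun t => b (y t) (y t))) => s.
  have := is_derive_bilinear_form blr bll (yd s).
  set d := (X in is_derive _ _ _ X); have -> // : d = 0.
  have bF : b (F s (y s)) (y s) = 0.
    rewrite /b /F /N linearN thK metricNl /radial linearZ /=.
    move: (th' (y s)) (r / _) => a k.
    pose nr : {linear g -> g} := HB.pack (nabla (k *: a))
      (GRing.isLinear.Build _ _ _ _ _ (nabr (k *: a))).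
    rewrite -[nabla _ _]/(nr (k *: a)) linearZ metricZl /=.
    have := metr (k *: a) a a; rewrite (metricC _ a) => E.
    have -> : form (nabla (k *: a) a) a = 0 by lra.
    by rewrite mulr0 oppr0.
  by rewrite /d bF add0r /b metricC; exact: bF.
have yr t : `|y t| <= r.
  rewrite -(th'K (y t)) (le_trans (thC _))// -/(b _ _) energy /r.
  by rewrite lerDl.
exists (th' \o y); first by rewrite /= y0 thK.
split; last by exists r => t; rewrite /= th'K.
move=> t; rewrite (_ : _ \o _ = y); last by apply/funext => s /=; rewrite th'K.
by have := yd t; rewrite /F radial_id.
Qed.

End GeodesicFlow.

(** * Curves with prescribed velocity in a Lie group *)
Section ChartProducts.
Context {R : realType} {n : nat} {G : lieGroupType R n}.
Implicit Types c : chart R n G.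

Definition mul_dom c1 c2 c3 : set ('rV[R]_n * 'rV[R]_n) :=
  [set z | [/\ chart_img c1 z.1, chart_img c2 z.2 &
     chart_dom c3 (chart_inv c1 z.1 * chart_inv c2 z.2)%g]].

Definition chart_mul c1 c2 c3 (z : 'rV[R]_n * 'rV[R]_n) : 'rV[R]_n :=
  chart_map c3 (chart_inv c1 z.1 * chart_inv c2 z.2)%g.

Lemma chart_img_map c p : chart_dom c p -> chart_img c (chart_map c p).
Proof. by move=> cp; exists p. Qed.

Lemma chart_invK c z : chart_img c z -> chart_map c (chart_inv c z) = z.
Proof. by move=> [p cp <-]; rewrite chart_mapK. Qed.

Lemma chart_inv_dom c z : chart_img c z -> chart_dom c (chart_inv c z).
Proof. by move=> [p cp <-]; rewrite chart_mapK. Qed.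

Lemma mul_dom_nbhs c1 c2 c3 z : mul_dom c1 c2 c3 z -> nbhs z (mul_dom c1 c2 c3).
Proof.
case=> i1 i2 d3.
have z1 : \forall u \near z, chart_img c1 u.1.
  have : nbhs z.1 (chart_img c1) by apply: open_nbhs_nbhs; split => //; exact: chart_img_open.
  exact: cvg_fst.
have z2 : \forall u \near z, chart_img c2 u.2.
  have : nbhs z.2 (chart_img c2) by apply: open_nbhs_nbhs; split => //; exact: chart_img_open.
  exact: cvg_snd.
have z3 : \forall u \near z, chart_dom c3 (chart_inv c1 u.1 * chart_inv c2 u.2)%g.
  have d3n : nbhs (chart_inv c1 z.1 * chart_inv c2 z.2)%g (chart_dom c3).
    by apply: open_nbhs_nbhs; split => //; exact: chart_dom_open.
  have cv1 : chart_inv c1 u.1 @[u --> z] --> chart_inv c1 z.1.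
    by apply: (cvg_comp fst (chart_inv c1)); [exact: cvg_fst|exact: chart_inv_continuous].
  have cv2 : chart_inv c2 u.2 @[u --> z] --> chart_inv c2 z.2.
    by apply: (cvg_comp snd (chart_inv c2)); [exact: cvg_snd|exact: chart_inv_continuous].
  have cv : (chart_inv c1 u.1, chart_inv c2 u.2) @[u --> z] -->
      (chart_inv c1 z.1, chart_inv c2 z.2) by exact: cvg_pair.
  have := cvg_comp _ _ cv (mulg_continuous (chart_inv c1 z.1, chart_inv c2 z.2)).
  exact.
by near=> u; split; near: u.
Unshelve. all: by end_near. Qed.

Lemma chart_mul_smooth c1 c2 c3 : atlas c1 -> atlas c2 -> atlas c3 ->
  smooth_on (mul_dom c1 c2 c3) (chart_mul c1 c2 c3).
Proof. exact: mulg_smooth. Qed.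

Lemma derive_pairl (W : normedModType R) (f : 'rV[R]_n * 'rV[R]_n -> W) e v z :
  'D_v (fun z => f (z, e)) z = 'D_(v, 0) f (z, e).
Proof.
rewrite /derive; set f1 := (fun h => _); set f2 := (fun h => _).
suff -> : f1 = f2 by [].
rewrite /f1 /f2 funeqE => h /=; congr (_ *: (f _ - _)).
rewrite -[RHS]/(h *: v + z, h *: (0 : 'rV[R]_n) + e).
by rewrite scaler0 add0r.
Qed.

Lemma derive_pairr (W : normedModType R) (f : 'rV[R]_n * 'rV[R]_n -> W) z v e :
  'D_v (fun w => f (z, w)) e = 'D_(0, v) f (z, e).
Proof.
rewrite /derive; set f1 := (fun h => _); set f2 := (fun h => _).
suff -> : f1 = f2 by [].
rewrite /f1 /f2 funeqE => h /=; congr (_ *: (f _ - _)).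
rewrite -[RHS]/(h *: (0 : 'rV[R]_n) + z, h *: v + e).
by rewrite scaler0 add0r.
Qed.

Lemma differentiable_pairl (W : normedModType R) (f : 'rV[R]_n * 'rV[R]_n -> W) z e :
  differentiable f (z, e) -> differentiable (fun z => f (z, e)) z.
Proof.
by move=> fd; apply: (@differentiable_comp _ _ _ _ (fun z => (z, e)) f) => //.
Qed.

Lemma differentiable_pairr (W : normedModType R) (f : 'rV[R]_n * 'rV[R]_n -> W) z e :
  differentiable f (z, e) -> differentiable (fun w => f (z, w)) e.
Proof.
by move=> fd; apply: (@differentiable_comp _ _ _ _ (fun w => (z, w)) f) => //.
Qed.

End ChartProducts.

Section LocalCurves.
Context {R : realType} {n : nat} {G : lieGroupType R n}.
Variable c : chart R n G.
Hypotheses (c_atlas : atlas c) (c1 : chart_dom c 1%g).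
Let e := chart_map c 1%g.
Let mu := chart_mul c c c.
(** The left-invariant field with value 'e_i at the neutral element, read in
    the chart. *)
Let frame i z : 'rV[R]_n := 'D_(0, 'e_i) mu (z, e).

Let inv_e : chart_inv c e = 1%g.
Proof. by rewrite /e chart_mapK. Qed.

Let dom_e z : chart_img c z -> mul_dom c c c (z, e).
Proof.
move=> iz; split => //=; first exact: chart_img_map.
by rewrite inv_e mulg1; exact: chart_inv_dom.
Qed.

Let near_e : \forall z \near e, chart_img c z.
Proof.
apply: open_nbhs_nbhs; split; first exact: chart_img_open.
exact: chart_img_map.
Qed.

Let mu_Ck k : Ck k (mul_dom c c c) mu.
Proof. exact: chart_mul_smooth. Qed.

Let frame_lipschitz i : exists C : R, 0 <= C /\ exists2 r : R, 0 < r &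
  forall z w, `|z - e| <= r -> `|w - e| <= r ->
    `|frame i z - frame i w| <= C * `|z - w|.
Proof.
have [_ /(_ (0, 'e_i)) [fd fc]] := mu_Ck 2.
apply: locally_lipschitz.
  by apply: filterS near_e => z /dom_e /fd; exact: differentiable_pairl.
move=> j; have -> : 'D_'e_j (frame i) =
    (fun z => 'D_('e_j, 0) ('D_(0, 'e_i) mu) (z, e)).
  by apply/funext => z; exact: derive_pairl.
have /(_ (e, e)) ce := fc ('e_j, 0).
have cont := ce (dom_e (chart_img_map c1)).
apply: (@cvg_comp _ _ _ (fun z => (z, e)) _ _ (nbhs (e, e)) _ _ cont).
move=> A [[B C] /= [Be Ce] BC]; apply: filterS Be => z Bz.
by apply: BC; split => //; exact: nbhs_singleton.
Qed.

Let frames_box : exists C : R, 0 <= C /\ exists2 r : R, 0 < r &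
  (forall z, `|z - e| <= r -> chart_img c z) /\
  forall i z w, `|z - e| <= r -> `|w - e| <= r ->
    `|frame i z - frame i w| <= C * `|z - w|.
Proof.
have /choice[C HC] := frame_lipschitz.
exists (\sum_i C i); split; first by apply: sumr_ge0 => i _; case: (HC i).
have Hr : \forall r \near (0 : R)^'+, forall i z w, `|z - e| <= r ->
    `|w - e| <= r -> `|frame i z - frame i w| <= (\sum_i C i) * `|z - w|.
  have H i : \forall r \near (0 : R)^'+, forall z w, `|z - e| <= r ->
      `|w - e| <= r -> `|frame i z - frame i w| <= (\sum_i C i) * `|z - w|.
    have [C0 [ri ri0 lip]] := HC i; near=> r => z w zr wr.
    have rri : r <= ri by near: r; exact: nbhs_right_le.
    apply: le_trans (lip z w (le_trans zr rri) (le_trans wr rri)) _.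
    rewrite ler_wpM2r// (bigD1 i)//= lerDl sumr_ge0// => j _.
    by case: (HC j).
  exact: (@filter_forall _ _ _ _ _ H).
have /nbhs_ballP[r0 /= r00 ballr] := near_e.
have Hi : \forall r \near (0 : R)^'+, forall z, `|z - e| <= r -> chart_img c z.
  near=> r => z zr; apply: ballr; rewrite -ball_normE /= distrC.
  by rewrite (le_lt_trans zr)//; near: r; exact: nbhs_right_lt.
have : \forall r \near (0 : R)^'+, 0 < r /\ ((forall z, `|z - e| <= r -> chart_img c z) /\
  forall i z w, `|z - e| <= r -> `|w - e| <= r ->
    `|frame i z - frame i w| <= (\sum_i C i) * `|z - w|).
  near=> r; split => //; split; near: r => //.
by move=> /filter_ex[r [r1 r2]]; exists r.
Unshelve. all: by end_near. Qed.

(** Left translation by the inverse of q, read in the chart. *)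
Let ztrans q z := chart_map c (q^-1 * chart_inv c z)%g.

Let ztrans_diff z : chart_img c z ->
  differentiable (ztrans (chart_inv c z)) z.
Proof.
move=> iz; set q := chart_inv c z.
have [c' atl' dom'] := atlas_cover (q^-1)%g.
have [fd _] := @chart_mul_smooth _ _ _ c' c c atl' c_atlas c_atlas 1.
have inv' : chart_inv c' (chart_map c' q^-1%g) = (q^-1)%g by rewrite chart_mapK.
have /differentiable_pairr : differentiable (chart_mul c' c c) (chart_map c' q^-1%g, z).
  apply: fd; split => //=; first exact: chart_img_map.
  by rewrite inv' mulVg.
rewrite (_ : (fun w => _) = ztrans q)//.
by apply/funext => w; rewrite /chart_mul /= inv'.
Qed.

(** Translating by z^-1 undoes the multiplication by z that defines the
    frame: the two differentials are inverse to each other. *)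
Let ztrans_velocity z (v : 'rV[R]_n) : chart_img c z ->
  'd (ztrans (chart_inv c z)) z (\sum_i v 0 i *: frame i z) = v.
Proof.
move=> iz; set q := chart_inv c z.
have mu_diff : differentiable mu (z, e).
  by have [fd _] := mu_Ck 1; exact/fd/dom_e.
have muz_diff := differentiable_pairr mu_diff.
have mu_ze : mu (z, e) = z.
  by rewrite /mu /chart_mul /= inv_e mulg1 chart_invK.
have -> : \sum_i v 0 i *: frame i z = 'd (fun w => mu (z, w)) e v.
  rewrite (diff_rV _ muz_diff); apply: eq_bigr => i _.
  by rewrite derive_pairr.
have td : differentiable (ztrans q) (mu (z, e)) by rewrite mu_ze; exact: ztrans_diff.
have := diff_comp muz_diff td; rewrite mu_ze => dE.
have -> : 'd (ztrans q) z ('d (fun w => mu (z, w)) e v) =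
    ('d (ztrans q) z \o 'd (fun w => mu (z, w)) e) v by [].
rewrite -dE -deriveE; last exact: differentiable_comp.
rewrite (@near_eq_derive _ _ _ _ id); first by rewrite derive_id.
have /mul_dom_nbhs := dom_e iz.
have pz : (z, w) @[w --> e] --> (z, e).
  move=> A [[B C] /= [Be Ce] BC]; apply: filterS Ce => w Cw.
  by apply: BC; split => //; exact: nbhs_singleton.
move=> /pz near_dom; have near_dom' : \forall w \near e, mul_dom c c c (z, w) by [].
apply: filterS2 near_dom' near_e => w [_ _ /= dw] iw.
by rewrite /= /ztrans /mu /chart_mul /= chart_mapK// mulKg chart_invK.
Qed.

(** In the chart, the equation is z' = sum_i y_i frame_i(z). The right-hand
    side is cut off by a radial retraction to a ball on which the frame is
    defined and Lipschitz; as the speed is at most S, the solution stays in this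
    ball during the time T = r / (S + 1). *)
Lemma local_curve (Y : R) : exists2 T : R, 0 < T &
  forall y : R -> 'rV[R]_n, continuous y -> (forall t, `|y t| <= Y) ->
  exists2 eta : R -> G, eta 0 = 1%g &
    forall t, `|t| <= T -> {for t, continuous eta} /\
      is_derive t 1 (fun s => chart_map c ((eta t)^-1 * eta s)%g) (y t).
Proof.
have [C [C0 [r r0 [img lip]]]] := frames_box.
pose B i := `|frame i e| + C * r.
have frame_le i z : `|z - e| <= r -> `|frame i z| <= B i.
  move=> zr; have er : `|e - e| <= r by rewrite subrr normr0 ltW.
  have := lip i z e zr er; have := ler_normD (frame i z - frame i e) (frame i e).
  rewrite subrK /B; have : C * `|z - e| <= C * r by rewrite ler_wpM2l.
  move: `|frame i z| `|frame i z - _| `|frame i e| (C * _) (C * r) => *; lra.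
have B0 i : 0 <= B i by rewrite addr_ge0// mulr_ge0// ltW.
pose Y' := Num.max 0 Y.
have Y'0 : 0 <= Y' by rewrite le_max lexx.
pose S := Y' * \sum_i B i.
have S0 : 0 <= S by rewrite mulr_ge0// sumr_ge0.
exists (r / (S + 1)); first by rewrite divr_gt0// ltr_wpDl.
move=> y yc yY; have yY' t i : `|y t 0 i| <= Y'.
  by rewrite (le_trans (rV_coord_le _ _))// (le_trans (yY t))// le_max lexx orbT.
pose ret z := e + radial r (z - e).
have ret_r z : `|ret z - e| <= r by rewrite /ret addrC addKr radial_norm.
have ret_lip z w : `|ret z - ret w| <= 2 * `|z - w|.
  have -> : ret z - ret w = radial r (z - e) - radial r (w - e).
    by rewrite /ret opprD addrACA subrr add0r.
  have -> : z - w = (z - e) - (w - e) by rewrite opprB addrA subrK.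
  exact: radial_lipschitz.
pose F t z := \sum_i y t 0 i *: frame i (ret z).
have F_le t z : `|F t z| <= S.
  rewrite (le_trans (ler_norm_sum _ _ _))// /S mulr_sumr ler_sum// => i _.
  by rewrite normrZ ler_pM// frame_le.
pose L := Y' * (C * 2) *+ n + 1.
have L0 : 0 < L by rewrite ltr_wpDl// mulrn_wge0// !mulr_ge0.
have FL t z w : `|F t z - F t w| <= L * `|z - w|.
  rewrite /F -sumrB (le_trans (ler_norm_sum _ _ _))//.
  apply: (@le_trans _ _ (\sum_(i < n) Y' * (C * 2) * `|z - w|)).
    apply: ler_sum => i _; rewrite -scalerBr normrZ -!mulrA ler_pM//.
    apply: le_trans (lip _ _ _ (ret_r z) (ret_r w)) _; rewrite ler_wpM2l//.
  by rewrite sumr_const card_ord /L mulrDl mul1r mulrnAl lerDl.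
have Fc z : continuous (F^~ z).
  move=> t; apply/cvgrPdist_le => d d0.
  have B1 : 0 < \sum_i B i + 1 by rewrite ltr_wpDl// sumr_ge0.
  have dB : 0 < d / (\sum_i B i + 1) by rewrite divr_gt0.
  have /cvgrPdist_le/(_ _ dB) := yc t; apply: filterS => s ys.
  rewrite /F -sumrB (le_trans (ler_norm_sum _ _ _))//.
  apply: (@le_trans _ _ (\sum_i d / (\sum_i B i + 1) * B i)).
    apply: ler_sum => i _; rewrite -scalerBl normrZ ler_pM// ?frame_le//.
    by have := rV_coord_le (y t - y s) i; rewrite !mxE => /le_trans; apply.
  by rewrite -mulr_sumr mulrAC ler_pdivrMr// ler_pM2l// lerDl.
have [z z0 zd] := picard L0 FL Fc (F_le^~ e).
have speed t := speed_le t S0 zd (fun s => F_le s (z s)).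
exists (chart_inv c \o z); first by rewrite /= z0.
move=> t tT; have zt : `|z t - e| <= r.
  rewrite -z0 (le_trans (speed t))//.
  apply: (@le_trans _ _ ((S + 1) * `|t|)); first by rewrite ler_wpM2r// lerDl.
  by rewrite mulrC -ler_pdivlMr// ltr_wpDl.
have iz := img _ zt.
have zc : {for t, continuous z} by exact: is_derive_continuous (zd t).
split; first exact: (cvg_comp _ _ zc (chart_inv_continuous iz)).
have := is_derive_diff_comp (zd t) (ztrans_diff iz).
rewrite /F (_ : ret (z t) = z t); last by rewrite /ret radial_id// addrC subrK.
by rewrite ztrans_velocity.
Qed.

Lemma int_sequence (step : int -> G) (p : G) :
  exists2 a : int -> G, a 0 = p & forall k, a (k + 1) = (a k * step k)%g.
Proof.
pose fwd := fix f m := if m is m'.+1 then (f m' * step (Posz m'))%g else p.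
pose bwd := fix f m := if m is m'.+1 then (f m' * (step (Negz m'))^-1)%g else p.
exists (fun k => match k with Posz m => fwd m | Negz m => bwd m.+1 end) => //.
case=> [m|[|m]].
- by rewrite -[Posz m + 1]/(Posz (m + 1)) addn1.
- by rewrite /= mulgVK.
- have -> : Negz m.+1 + 1 = Negz m by rewrite !NegzE -[m.+2]addn1 PoszD opprD subrK.
  by rewrite /= mulgVK.
Qed.

(** On the interval from k T to (k + 1) T the curve is a left translate of a
    local solution centred at k T. The local solutions are valid up to the time
    2 T, so that consecutive pieces overlap around their common endpoint. *)
Theorem curve_of_velocity (y : R -> 'rV[R]_n) (Y : R) (p : G) :
  continuous y -> (forall t, `|y t| <= Y) ->
  exists2 gamma : R -> G, gamma 0 = p & continuous gamma /\
    forall t : R, is_derive t 1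
      (fun s => chart_map c ((gamma t)^-1 * gamma s)%g) (y t).
Proof.
move=> yc yY; have [T2 T20 local] := local_curve Y.
pose T := T2 / 2; have T0 : 0 < T by rewrite divr_gt0.
have /choice[eta etaP] : forall k : int, exists eta : R -> G, eta 0 = 1%g /\
    forall t, `|t| <= T2 -> {for t, continuous eta} /\
      is_derive t 1 (fun s => chart_map c ((eta t)^-1 * eta s)%g) (y (t + k%:~R * T)).
  move=> k; have [||eta e0 ed] := local (fun t => y (t + k%:~R * T)).
  - move=> t; apply: (@cvg_comp _ _ _ (fun t => t + k%:~R * T) y) (yc _).
    by apply: cvgD; [exact: cvg_id|exact: cvg_cst].
  - by move=> t; exact: yY.
  by exists eta.
have [a a0 aS] := int_sequence (fun k => eta k T) p.
pose sigma k t := (a k * eta k (t - k%:~R * T))%g.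
pose gamma t := sigma (Num.floor (t / T)) t.
have sigmaP k t : `|t - k%:~R * T| <= T2 -> {for t, continuous (sigma k)} /\
    is_derive t 1 (fun s => chart_map c ((sigma k t)^-1 * sigma k s)%g) (y t).
  move=> tT; have [ec ed] := (etaP k).2 _ tT; split.
    have sh : (s - k%:~R * T) @[s --> t] --> t - k%:~R * T.
      by apply: cvgB; [exact: cvg_id|exact: cvg_cst].
    have cv : eta k (s - k%:~R * T) @[s --> t] --> eta k (t - k%:~R * T).
      exact: cvg_comp _ _ sh ec.
    have cva : a k @[s --> t] --> a k by exact: cvg_cst.
    have cv2 : (a k, eta k (s - k%:~R * T)) @[s --> t] -->
      (a k, eta k (t - k%:~R * T)) by exact: cvg_pair.
    exact: (cvg_comp _ _ cv2 (mulg_continuous (_, _))).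
  have := is_derive_translate ed; rewrite subrK.
  rewrite (_ : (fun s => _) = (fun s => chart_map c ((sigma k t)^-1 * sigma k s)%g))//.
  by apply/funext => s; rewrite /sigma invgM -mulgA mulKg.
have sigma_glue k : sigma (k - 1) (k%:~R * T) = sigma k (k%:~R * T).
  rewrite /sigma subrr (etaP k).1 mulg1 -[in RHS](subrK 1 k) aS.
  by congr (_ * eta _ _)%g; rewrite intrB -mulrBl opprB addrC subrK mul1r.
have floorE k t : k%:~R * T <= t -> t < (k + 1)%:~R * T -> gamma t = sigma k t.
  move=> kt tk; rewrite /gamma (@floor_def _ _ k)//.
  by rewrite ler_pdivlMr// kt ltr_pdivrMr.
have gammaP t : {for t, continuous gamma} /\ is_derive t 1
    (fun s => chart_map c ((gamma t)^-1 * gamma s)%g) (y t).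
  pose k := Num.floor (t / T).
  have kt : k%:~R * T <= t by rewrite -ler_pdivlMr// floor_le_tmp.
  have tk : t < (k + 1)%:~R * T by rewrite -ltr_pdivrMr// floorD1_gt.
  have k1T : (k + 1)%:~R * T = k%:~R * T + T by rewrite intrD mulrDl mul1r.
  have km1T : (k - 1)%:~R * T = k%:~R * T - T by rewrite intrB mulrBl mul1r.
  have T2E : T2 = T + T by rewrite -splitr.
  have [sc sd] : {for t, continuous (sigma k)} /\
    is_derive t 1 (fun s => chart_map c ((sigma k t)^-1 * sigma k s)%g) (y t).
    by apply: sigmaP; rewrite ger0_norm ?subr_ge0//; lra.
  have gt : gamma t = sigma k t by [].
  (* Near t the curve is a concatenation of two pieces with the same value and
     the same velocity at t. *)
  have [h [ht hn hc hd]] : exists h : R -> G, [/\ h t = gamma t,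
      \forall s \near t, h s = gamma s, {for t, continuous h} &
      is_derive t 1 (fun s => chart_map c ((gamma t)^-1 * h s)%g) (y t)].
    move: kt; rewrite le_eqVlt => /predU1P[kt|kt].
      have gt' : gamma t = sigma (k - 1) t by rewrite gt -kt sigma_glue.
      have [sc' sd'] : {for t, continuous (sigma (k - 1))} /\
          is_derive t 1 (fun s => chart_map c ((sigma (k - 1) t)^-1 *
            sigma (k - 1) s)%g) (y t).
        by apply: sigmaP; rewrite km1T ger0_norm; lra.
      exists (fun s => if s < t then sigma (k - 1) s else sigma k s); split.
      - by rewrite ltxx gt.
      - have /cvgrPdist_lt/(_ T T0) : {for t, continuous (fun s : R => s)} by [].
        apply: filterS => s; rewrite ltr_norml => /andP[ts1 ts2].
        case: ltP => st; apply/esym/floorE; rewrite ?subrK ?km1T ?k1T; lra.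
      - by apply: continuous_if => //; rewrite -gt' gt.
      - rewrite (_ : (fun s => _) = (fun s => if s < t
          then chart_map c ((gamma t)^-1 * sigma (k - 1) s)%g
          else chart_map c ((gamma t)^-1 * sigma k s)%g)); last first.
          by apply/funext => s; case: ifP.
        apply: is_derive_if; first by rewrite -gt -gt'.
        rewrite gt'; exact: sd'.
    exists (sigma k); split => //.
    have /cvgrPdist_lt/(_ (Num.min (t - k%:~R * T) ((k + 1)%:~R * T - t))) :
      {for t, continuous (fun s : R => s)} by [].
    rewrite lt_min !subr_gt0 kt tk => /(_ isT); apply: filterS => s.
    rewrite lt_min !ltr_norml => /andP[/andP[? ?] /andP[? ?]].
    by apply/esym/floorE; lra.
  split.
    move=> A; rewrite -ht => /hc; apply: filterS2 hn => s /= <-.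
    by [].
  apply: near_eq_is_derive hd; apply: filterS hn => s ->.
  by [].
exists gamma; last by split=> t; case: (gammaP t).
rewrite (floorE 0 0) ?mul0r//; last by rewrite add0r mul1r.
by rewrite /sigma mul0r subr0 (etaP 0).1 mulg1.
Qed.

End LocalCurves.

(** * Completeness in the definite case *)
Section CompletenessDefinite.
Context {R : realType} {g : vectType R} {n : nat} {G : lieGroupType R n}.
Variables (c : chart R n G) (theta : {linear g -> 'rV[R]_n}).
Variables (br nabla : g -> g -> g).
Hypotheses (c_atlas : atlas c) (c1 : chart_dom c 1%g).
Hypotheses (theta_bij : bijective theta).

Theorem positive_definite_complete (form : {symmetric g}) :
  positive_definite form -> is_levi_civita br form nabla ->
  geodesically_complete c theta nabla.
Proof.
move=> form_pos LC p v.
have [x x0 [xgeo [Y xY]]] := geodesic_flow theta_bij LC form_pos v.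
have xc : continuous (theta \o x).
  by move=> t; exact: is_derive_continuous (xgeo t).
have [gamma g0 [gc gv]] := curve_of_velocity c_atlas c1 p xc xY.
by exists gamma, x.
Qed.

Lemma negative_definite_complete (form : {symmetric g}) :
  negative_definite form -> is_levi_civita br form nabla ->
  geodesically_complete c theta nabla.
Proof.
move=> neg LC.
exact: positive_definite_complete (opp_form_positive neg) (opp_form_levi_civita LC).
Qed.

End CompletenessDefinite.

Lemma dimv_gt0_bijective (R : fieldType) (V : vectType R) n
    (f : {linear V -> 'rV[R]_n}) :
  (0 < n)%N -> bijective f -> (0 < \dim {:V})%N.
Proof.
case: n f => // n f _ [f' fK f'K]; rewrite lt0n; apply/negP.
rewrite dimv_eq0 => /eqP V0.
have : f' (const_mx 1) \in {:V}%VS by rewrite memvf.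
rewrite V0 memv0 => /eqP f'0; have := f'K (const_mx 1).
rewrite f'0 linear0 => /rowP/(_ 0); rewrite !mxE => /esym/eqP.
by rewrite oner_eq0.
Qed.

Local Close Scope classical_set_scope.

Theorem theorem1p1 (R : realType) :
  (forall (g : vectType R) (form : {symmetric g}) (B : 'End(g)) (u : g)
      (lambda : R),
    nondegenerate form -> skew_symmetric form B -> form u u != 0 ->
    lambda != 0 -> B u = 0 ->
    let br := special_bracket form u (B + lambda *: \1%VF) in
    pseudo_euclidean_lie_algebra br form /\
    exists nabla : g -> g -> g,
      [/\ is_levi_civita br form nabla,
          constant_curvature br form nabla (- form u u * lambda ^+ 2) &
          forall (n : nat) (G : lieGroupType R n) (c : chart R n G)
              (theta : g -> 'rV[R]_n),
            simply_connected R G -> is_lie_algebra_of c theta br ->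
            (~ negative_definite form ->
               (geodesically_complete c theta nabla <->
                positive_definite form)) /\
            (negative_definite form -> geodesically_complete c theta nabla)])
  /\
  (forall (n : nat) (G : lieGroupType R n) (g : vectType R)
      (br : g -> g -> g) (c : chart R n G) (theta : g -> 'rV[R]_n)
      (form : {symmetric g}) (nabla : g -> g -> g) (k : R),
    (0 < n)%N -> is_lie_algebra_of c theta br ->
    pseudo_euclidean_lie_algebra br form -> positive_definite form ->
    is_levi_civita br form nabla -> k < 0 ->
    constant_curvature br form nabla k ->
    exists (V : vectType R) (formV : {symmetric V}) (B' : 'End(V)) (u' : V)
        (lambda' : R) (f : 'Hom(g, V)),
      let brV := special_bracket formV u' (B' + lambda' *: \1%VF) in
      [/\ nondegenerate formV, skew_symmetric formV B',
          formV u' u' != 0, B' u' = 0 & lambda' != 0] /\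
      [/\ pseudo_euclidean_lie_algebra brV formV, bijective f,
          forall x y, f (br x y) = brV (f x) (f y) &
          forall x y, formV (f x) (f y) = form x y]).
Proof.
split=> [g form B u lambda form_nd B_skew u0 lambda0 Bu br|].
  split; first exact: special_pseudo_euclidean.
  have LC := special_levi_civita u lambda B_skew.
  exists (special_nabla form B u lambda); split => //.
    exact: special_constant_curvature.
  move=> n G c theta _ lie; have [c_atlas c1 theta_lin theta_bij _] := lie.
  pose theta' : {linear g -> 'rV[R]_n} :=
    HB.pack theta (GRing.isLinear.Build _ _ _ _ _ theta_lin).
  split=> [not_neg|neg].
    split=> [compl|pos].
      have [//|/not_neg//] := complete_definite form_nd B_skew u0 lambda0 Bu
        (theta := theta') theta_bij compl.
    exact: (positive_definite_complete c_atlas c1 (theta := theta') theta_bij pos LC).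
  exact: (negative_definite_complete c_atlas c1 (theta := theta') theta_bij neg LC).
move=> n G g br c theta form nabla k n0 lie [form_nd br_lie] pos LC k0 curv.
have [_ _ theta_lin theta_bij _] := lie.
pose theta' : {linear g -> 'rV[R]_n} :=
  HB.pack theta (GRing.isLinear.Build _ _ _ _ _ theta_lin).
have dim0 : (0 < \dim {:g})%N by exact: (dimv_gt0_bijective (f := theta') n0).
have [B [u [lambda [B_skew u0 Bu lambda0 brE]]]] :=
  negative_curvature_special pos LC k0 curv dim0.
exists g, form, B, u, lambda, \1%VF => brV; split; first by split.
split.
- exact: special_pseudo_euclidean.
- by exists id => x; rewrite id_lfunE.
- by move=> x y; rewrite !id_lfunE brE.
- by move=> x y; rewrite !id_lfunE.
Qed.
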